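(* Let $S$ be a generic non-singular tropical surface in $\mathbb{T}P^3$ of degree $d$. If $d=3$, then there exist finitely many tropical lines $L\subset S$ such that the pair $(S,L)$ is approximable. If $d\ge 4$, then there exist no tropical lines $L\subset S$ such that the pair $(S,L)$ is approximable.
   Context: Let $\Delta_d=\mathrm{Conv}\{(0,0,0),(d,0,0),(0,d,0),(0,0,d)\}$. A tropical surface of degree $d$ is the tropical hypersurface in $\mathbb{R}^3$ defined by a tropical polynomial $\max_{i}(a_i+\langle i,x\rangle)$ with Newton polytope $\Delta_d$ (together with its closure in tropical projective space $\mathbb{T}P^3\supset\mathbb{R}^3$). It is dual to a lattice subdivision of $\Delta_d$, and is non-singular if this subdivision is a triangulation into primitive simplices (lattice simplices with the volume of the standard simplex). ''Generic'' is meant in the sense of Vigeland: for each regular primitive triangulation of $\Delta_d$, the coefficient vector $(a_i)$ lies in a suitable open dense subset of the open cone of coefficient vectors inducing this triangulation. A tropical line in $\mathbb{R}^3$ is a degree 1 tropical curve: a balanced tree with all weights 1 and four unbounded rays in directions $(-1,0,0),(0,-1,0),(0,0,-1),(1,1,1)$, having either two 3-valent vertices joined by a bounded edge or one 4-valent vertex; in $\mathbb{T}P^3$ one takes its closure. Let $\mathrm{Log}_t:(\mathbb{C}^* )^3\to\mathbb{R}^3$, $(z_i)\mapsto(\log|z_i|/\log t)$. The pair $(S,L)$ with $L\subset S$ is approximable if there exist one-parameter families of complex algebraic varieties $\mathcal{L}_t\subset\mathcal{S}_t\subset(\mathbb{C}^* )^3$, $\mathcal{S}_t$ an algebraic surface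 with Newton polytope $\Delta_d$ and $\mathcal{L}_t$ an algebraic line, such that $\lim_{t\to\infty}\mathrm{Log}_t(\mathcal{S}_t)=S$ and $\lim_{t\to\infty}\mathrm{Log}_t(\mathcal{L}_t)=L$ (Hausdorff convergence on compact sets, with the limits carrying their natural weights). *)

(* Defs.v *)
From HB Require Import structures.
From mathcomp Require Import all_boot all_order all_algebra.
From mathcomp Require Import perm generic_quotient complex.
From mathcomp Require Import all_classical all_reals all_analysis.

Set Implicit Arguments.
Unset Strict Implicit.
Unset Printing Implicit Defensive.

Import Order.TTheory GRing.Theory Num.Theory.
Import numFieldNormedType.Exports.

Local Open Scope classical_set_scope.
Local Open Scope ring_scope.

(** * Lattice points of the simplex and convex hulls *)

(* The lattice points of Delta_d = Conv {0, d e_1, d e_2, d e_3}. *)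
Definition lattice_pt (d : nat) : Type :=
  {i : {ffun 'I_3 -> 'I_d.+1} | (\sum_j i j <= d)%N}.
HB.instance Definition _ d := Finite.on (lattice_pt d).

Definition coord d (i : lattice_pt d) (j : 'I_3) : nat := val i j.

Definition pt_vec (R : pzSemiRingType) d (i : lattice_pt d) : 'rV[R]_3 :=
  \row_j (coord i j)%:R.

Definition convex_hull (R : realType) (A : set 'rV[R]_3) : set 'rV[R]_3 :=
  smallest [set B | convex_set (B : set (convex_lmodType 'rV[R]_3))] A.

Definition Delta (R : realType) (d : nat) : set 'rV[R]_3 :=
  convex_hull [set v | v = 0 \/ exists j, v = d%:R *: delta_mx 0 j].
Arguments Delta : clear implicits.

(** * Tropical projective space *)

(* TP^3 is the set of (w_0, ..., w_3) in [-oo, +oo[^4 other than (-oo, ..., -oo),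
   modulo addition of a common real constant, with the quotient topology. *)
Definition hcoords (R : realType) : set 'rV[\bar R]_4 :=
  [set w | (forall i, w 0 i != +oo%E) /\ (exists i, w 0 i != -oo%E)].
Arguments hcoords : clear implicits.

Section TropicalProjectiveSpace.
Context {R : realType}.

Definition hequiv : rel (hcoords R) := fun w w' =>
  `[< exists c : R, forall i, val w' 0 i = (val w 0%R i + c%:E)%E >].

Lemma hequiv_refl : reflexive hequiv.
Proof. by move=> w; apply/asboolP; exists 0 => i; rewrite adde0. Qed.

Lemma hequiv_sym : symmetric hequiv.
Proof.
move=> w w'; apply/asboolP/asboolP => -[c wc]; exists (- c) => i;
  by rewrite wc -addeA -EFinD subrr adde0.
Qed.

Lemma hequiv_trans : transitive hequiv.
Proof.
move=> w' w w'' /asboolP[c wc] /asboolP[c' wc']; apply/asboolP.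
by exists (c + c') => i; rewrite wc' wc EFinD addeA.
Qed.

Canonical hequiv_equiv := EquivRel hequiv hequiv_refl hequiv_sym hequiv_trans.

Definition TP3 : Type := quotient_topology {eq_quot hequiv_equiv}%qT.
HB.instance Definition _ := Topological.on TP3.

Definition affine_hcoords (x : 'rV[R]_3) : 'rV[\bar R]_4 :=
  \row_i (if unlift ord0 i is Some j then (x 0 j)%:E else 0%E).

Lemma affine_hcoordsP x : affine_hcoords x \in hcoords R.
Proof.
apply/mem_set; split=> [i|]; last by exists ord0; rewrite mxE unlift_none.
by rewrite mxE; case: unliftP.
Qed.

(* The embedding x |-> [0 : x_1 : x_2 : x_3] of R^3 into TP^3. *)
Definition to_TP3 (x : 'rV[R]_3) : TP3 :=
  \pi_TP3%qT (exist _ (affine_hcoords x) (affine_hcoordsP x) : hcoords R).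

Definition TP3_closure (X : set 'rV[R]_3) : set TP3 := closure (to_TP3 @` X).

Definition affine_part (X : set TP3) : set 'rV[R]_3 := to_TP3 @^-1` X.

End TropicalProjectiveSpace.
Arguments TP3 : clear implicits.

(** * Tropical surfaces *)

Section TropicalSurface.
Context {R : realType} {d : nat}.

(* A coefficient vector is real-valued on all of Delta_d: no coefficient is -oo,
   since every lattice point is a vertex of a primitive triangulation. *)
Implicit Types (a : lattice_pt d -> R) (x : 'rV[R]_3) (T : {set {set lattice_pt d}}).

Definition trop_term a x (i : lattice_pt d) : R :=
  a i + \sum_j pt_vec R i 0 j * x 0 j.

Definition argmax_set a x : {set lattice_pt d} :=
  [set i | [forall j, trop_term a x j <= trop_term a x i]].

Definition affine_tropical_surface a : set 'rV[R]_3 :=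
  [set x | (1 < #|argmax_set a x|)%N].

Definition tropical_surface a : set (TP3 R) :=
  TP3_closure (affine_tropical_surface a).

(* The cell dual to x is the convex hull of [argmax_set a x]; it is represented
   by this set of lattice points. *)
Definition dual_subdivision a : {set {set lattice_pt d}} :=
  [set A : {set lattice_pt d} | `[< exists x, A = argmax_set a x >]].

Definition primitive_simplex (A : {set lattice_pt d}) : Prop :=
  exists v : 'I_4 -> lattice_pt d,
    A = [set v k | k : 'I_4] /\
    `|\det (\matrix_(k < 3, j < 3)
        (pt_vec int (v (lift ord0 k)) 0 j - pt_vec int (v ord0) 0 j))| = 1.

(* Lower-dimensional cells are faces of the inclusion-maximal ones. *)
Definition primitive_triangulation T : Prop :=
  forall A, A \in T -> (forall B, B \in T -> A \subset B -> B = A) ->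
    primitive_simplex A.

Definition cone_of T : set {ptws lattice_pt d -> R} :=
  [set a | dual_subdivision a = T].

Definition regular_primitive_triangulation T : Prop :=
  cone_of T !=set0 /\ primitive_triangulation T.

End TropicalSurface.

(** * Tropical lines *)

Section TropicalLine.
Context {R : realType}.
Implicit Types (p q : 'rV[R]_3) (L : set 'rV[R]_3).

(* (1,1,1), -e_1, -e_2, -e_3 *)
Definition line_dir (i : 'I_4) : 'rV[int]_3 :=
  if unlift ord0 i is Some j then - delta_mx 0 j else const_mx 1.

Definition ray p (u : 'rV[int]_3) : set 'rV[R]_3 :=
  [set x | exists2 l : R, 0 <= l & x = p + l *: map_mx intr u].

Definition segment p q : set 'rV[R]_3 :=
  [set x | exists2 l : R, 0 <= l <= 1 & x = p + l *: (q - p)].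

(* In the second case [v] is the direction of the bounded edge leaving [p]. The
   equation is the balancing condition at [p]; the one at [q] follows because
   the four ray directions sum to 0. It makes [v] primitive, so that the edge
   has weight 1. *)
Definition affine_tropical_line L : Prop :=
  (exists p, L = \bigcup_(i in [set: 'I_4]) ray p (line_dir i)) \/
  (exists (p q : 'rV[R]_3) (s : {perm 'I_4}) (v : 'rV[int]_3) (l : R),
    [/\ line_dir (s (inord 0)) + line_dir (s (inord 1)) + v = 0,
        0 < l, q = p + l *: map_mx intr v &
        L = ray p (line_dir (s (inord 0))) `|` ray p (line_dir (s (inord 1)))
            `|` segment p q
            `|` ray q (line_dir (s (inord 2))) `|` ray q (line_dir (s (inord 3)))]).

Definition tropical_line (L : set (TP3 R)) : Prop :=
  exists2 L0, affine_tropical_line L0 & L = TP3_closure L0.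

End TropicalLine.

(** * Complex surfaces and lines in the torus, and their tropical limits *)

Section Approximation.
Context {R : realType}.
Local Notation C := (complex R).

Definition torus (n : nat) : set 'rV[C]_n := [set z | forall j, z 0 j != 0].
Arguments torus : clear implicits.

Definition Log (n : nat) (t : R) (z : 'rV[C]_n) : 'rV[R]_n :=
  \row_j (ln (ComplexField.Normc.normc (z 0 j)) / ln t).

Definition monomial_map (n k : nat) (M : 'M[int]_(n, k)) (z : 'rV[C]_n) : 'rV[C]_k :=
  \row_j \prod_i z 0 i ^ M i j.

Definition newton_polytope d (P : lattice_pt d -> C) : set 'rV[R]_3 :=
  convex_hull [set pt_vec R i | i in [set i | P i != 0]].

Definition torus_surface d (X : set 'rV[C]_3) : Prop :=
  exists2 P : lattice_pt d -> C, newton_polytope P = Delta R d &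
    X = torus 3 `&` [set z | \sum_i P i * \prod_j z 0 j ^+ coord i j = 0].

Definition torus_line (X : set 'rV[C]_3) : Prop :=
  exists p v : 'rV[C]_3,
    v != 0 /\ X = torus 3 `&` [set z | exists s : C, z = p + s *: v].

(* Hausdorff convergence on compact sets, as t tends to +oo. *)
Definition hausdorff_limit (A : R -> set 'rV[R]_3) (X : set 'rV[R]_3) : Prop :=
  forall (K : set 'rV[R]_3) (e : R), compact K -> 0 < e ->
    \forall t \near +oo,
      (forall x, (X `&` K) x -> exists2 y, A t y & `|x - y| < e) /\
      (forall y, (A t `&` K) y -> exists2 x, X x & `|x - y| < e).

(* Let p lie in the relative interior of a k-dimensional facet of X whose integer
   tangent directions have the rows of B as a basis, and let M be integral with
   B M = 1. The natural weight at p of the limit of Log_t (X_t) is the degree of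
   the covering z |-> z^M of (C^* )^k by the part of X_t lying over a small
   neighbourhood of p. Here this weight is required to be 1, which is the weight
   of every facet of a non-singular tropical surface and of a tropical line. *)
Definition limit_has_weight_one (k : nat) (Xt : R -> set 'rV[C]_3)
    (X : set 'rV[R]_3) : Prop :=
  forall (p : 'rV[R]_3) (B : 'M[int]_(k, 3)) (M : 'M[int]_(3, k)),
    B *m M = 1%:M ->
    (\forall x \near p,
       X x <-> exists c : 'rV[R]_k, x = p + c *m map_mx intr B) ->
    \forall e \near 0^'+, exists2 delta : R, 0 < delta &
      \forall t \near +oo, forall c : 'rV[C]_k, torus k c ->
        `|Log t c - p *m map_mx intr M| < delta ->
        exists! z, [/\ Xt t z, `|Log t z - p| < e & monomial_map M z = c].

Definition tropical_limit (k : nat) (Xt : R -> set 'rV[C]_3)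
    (X : set 'rV[R]_3) : Prop :=
  hausdorff_limit (fun t => Log t @` Xt t) X /\ limit_has_weight_one k Xt X.

Definition approximable (d : nat) (S L : set (TP3 R)) : Prop :=
  exists St Lt : R -> set 'rV[C]_3,
    [/\ forall t, 1 < t -> [/\ torus_surface d (St t), torus_line (Lt t)
                             & Lt t `<=` St t],
        tropical_limit 2 St (affine_part S) &
        tropical_limit 1 Lt (affine_part L)].

End Approximation.

(* "Generic" for the surfaces dual to a given T: P holds for all coefficient
   vectors in some open dense subset of the cone of those inducing T. *)
Definition generically (R : realType) (d : nat) (T : {set {set lattice_pt d}})
    (P : (lattice_pt d -> R) -> Prop) : Prop :=
  exists U : set {ptws lattice_pt d -> R},
    [/\ U `<=` cone_of T, open U, cone_of T `<=` closure U
      & forall a, U a -> P a].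

(* Main.v *)
Require Import Defs.
From mathcomp Require Import all_boot all_order all_algebra.
From mathcomp Require Import perm complex.
From mathcomp Require Import all_classical all_reals all_analysis.
From mathcomp Require Import ring lra zify.

Set Implicit Arguments.
Unset Strict Implicit.
Unset Printing Implicit Defensive.

Import Order.TTheory GRing.Theory Num.Theory.
Import numFieldNormedType.Exports.

Local Open Scope classical_set_scope.
Local Open Scope ring_scope.

(** The coefficients of a complex surface that contains a line satisfy algebraic
    relations as soon as there are fewer parameters for such pairs than
    coefficients, and an algebraic relation between functions of [t] becomes,
    through the orders of growth [lim log_t |y t|], a linear relation between
    these orders. A generic vector [a] satisfies no such relation.

    In more detail, let the complex surfaces [S_t], with equations [P t], and the
    lines [L_t] in them approximate the tropical surface [S] of [a] and a tropical
    line [L].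

    - After division by a common factor, [P t i] grows like [t ^ a i], for each
      lattice point [i] of the simplex ([coeff_growth]). Over a point of the facet
      of [S] that is dual to an edge from [i] to [j] there are points of [S_t], at
      which the terms [i] and [j] of [P t] have to cancel each other. So if [i] has
      the expected order, so has [j] ([edge_comparable]); and the edges of the
      triangulation connect all lattice points ([edge_connected]), because all of
      them are vertices of it ([covering], [lattice_pt_in_simplex]).

    - Write [L_t] as [z1 = al z0 + be, z2 = ga z0 + de]. Comparing the terms of
      these equations, and of the one between [z1] and [z2], at three points of
      [L_t] that are close to three points of [L] shows that [al], [be], [ga], [de]
      and [al de - be ga] have orders of growth, and that these determine [L]
      ([line_growth], [approximable_growth], [finitely_many_lines]).

    - The vanishing of [P t] on [L_t] expresses the [d + 1] coefficients of the
      powers of [z0] as polynomials in the other coefficients and in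
      [al, be, ga, de] ([surface_coeffE]). With [N] coefficients, there are
      [N - (d + 1) + 4] parameters.

    If [d >= 4], there are fewer parameters than coefficients, hence a polynomial
    relation between the coefficients alone ([algebraically_dependent]). Two of its
    monomials have the same order of growth ([tropical_relation]), which is a
    linear relation between the [a i]: there is no approximable line ([no_growth]).
    If [d = 3], the two numbers are equal, and each of the five quantities above is
    in a polynomial relation with the coefficients. Again two of its monomials have
    the same order; for generic [a] they differ in the exponent of that quantity,
    which leaves finitely many values for its order ([finite_growth]).

    The vectors [a] in the cone of a triangulation for which the linear relations
    of bounded height fail form an open dense subset of the cone, as the cone
    itself is open ([cone_of_open], [generically_generic_coeffs]). *)

(** * Algebraic dependence of polynomial functions *)

Section AlgebraicDependence.
Context {C : fieldType} {I : finType}.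
Implicit Types (f g : (I -> C) -> C) (k : nat).

(** Polynomials are represented by their values. The degree is bounded in each
    variable separately, so that the exponents form a finite type. *)
Definition poly_fun_of_degree k f : Prop :=
  exists c : {ffun I -> 'I_k.+1} -> C,
    forall x, f x = \sum_e c e * \prod_i x i ^+ e i.

Definition poly_fun f : Prop := exists k, poly_fun_of_degree k f.

Lemma eq_poly_fun_of_degree k f g :
  f =1 g -> poly_fun_of_degree k f -> poly_fun_of_degree k g.
Proof. by move=> /funext ->. Qed.

Lemma eq_poly_fun f g : f =1 g -> poly_fun f -> poly_fun g.
Proof. by move=> /funext ->. Qed.

Lemma poly_fun_of_terms k (J : finType) (c : J -> C) (e : J -> I -> nat) f :
    (forall j i, (e j i <= k)%N) ->
    (forall x, f x = \sum_j c j * \prod_i x i ^+ e j i) ->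
  poly_fun_of_degree k f.
Proof.
move=> ek fE.
exists (fun u => \sum_(j | [ffun i => inord (e j i)] == u) c j) => x.
rewrite fE (partition_big (fun j => [ffun i => inord (e j i)] : {ffun I -> 'I_k.+1}) predT) //=.
apply: eq_bigr => u _; rewrite mulr_suml; apply: eq_bigr => j /eqP <-.
by congr (_ * _); apply: eq_bigr => i _; rewrite ffunE inordK // ltnS.
Qed.

Lemma poly_fun_of_degreeW k k' f : (k <= k')%N ->
  poly_fun_of_degree k f -> poly_fun_of_degree k' f.
Proof.
move=> kk' [c fE]; apply: (@poly_fun_of_terms k' _ c (fun u i => u i) f) => //.
by move=> u i; rewrite (leq_trans _ kk') // -ltnS.
Qed.

Lemma poly_fun_of_degree_cst (a : C) : poly_fun_of_degree 0 (fun=> a).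
Proof.
apply: (@poly_fun_of_terms 0 _ (fun _ : 'I_1 => a) (fun _ _ => 0%N)) => // x.
by rewrite big_ord1 big1 ?mulr1 // => i _; rewrite expr0.
Qed.

Lemma poly_fun_of_degree_var i : poly_fun_of_degree 1 (fun x => x i).
Proof.
apply: (@poly_fun_of_terms 1 _ (fun _ : 'I_1 => 1) (fun _ j => (j == i) : nat)) => [_ j|x].
  by case: eqP.
rewrite big_ord1 mul1r (bigD1 i) //= eqxx expr1 big1 ?mulr1 // => j /negPf ->.
by rewrite expr0.
Qed.

Lemma poly_fun_of_degreeD k k' f g :
  poly_fun_of_degree k f -> poly_fun_of_degree k' g ->
  poly_fun_of_degree (maxn k k') (fun x => f x + g x).
Proof.
move=> /(poly_fun_of_degreeW (leq_maxl k k'))[c fE].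
move=> /(poly_fun_of_degreeW (leq_maxr k k'))[c' gE].
exists (fun u => c u + c' u) => x; rewrite fE gE -big_split /=.
by apply: eq_bigr => u _; rewrite mulrDl.
Qed.

Lemma poly_fun_of_degreeM k k' f g :
  poly_fun_of_degree k f -> poly_fun_of_degree k' g ->
  poly_fun_of_degree (k + k') (fun x => f x * g x).
Proof.
move=> [c fE] [c' gE].
apply: (@poly_fun_of_terms _ _ (fun uv : _ * _ => c uv.1 * c' uv.2)
  (fun uv i => (uv.1 i + uv.2 i)%N)) => [[u v] i|x] /=.
  by rewrite leq_add // -ltnS.
rewrite fE gE big_distrlr pair_big /=; apply: eq_bigr => -[u v] _ /=.
under [in RHS]eq_bigr do rewrite exprD.
by rewrite big_split /= mulrACA.
Qed.

Lemma poly_fun_of_degreeX k f n :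
  poly_fun_of_degree k f -> poly_fun_of_degree (n * k) (fun x => f x ^+ n).
Proof.
move=> fk; elim: n => [|n IHn]; first exact: poly_fun_of_degree_cst.
rewrite mulSn; apply: eq_poly_fun_of_degree (poly_fun_of_degreeM fk IHn) => x.
by rewrite exprS.
Qed.

Lemma poly_fun_of_degree_prod k (J : Type) (s : seq J) (n : J -> nat)
    (F : J -> (I -> C) -> C) :
  (forall j, poly_fun_of_degree k (F j)) ->
  poly_fun_of_degree (\sum_(j <- s) n j * k) (fun x => \prod_(j <- s) F j x ^+ n j).
Proof.
move=> Fk; elim: s => [|j s IHs].
  rewrite big_nil; apply: eq_poly_fun_of_degree (poly_fun_of_degree_cst 1) => x.
  by rewrite big_nil.
rewrite big_cons.
apply: eq_poly_fun_of_degree (poly_fun_of_degreeM (poly_fun_of_degreeX _ (Fk j)) IHs).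
by move=> x; rewrite big_cons.
Qed.

Lemma poly_fun_cst (a : C) : poly_fun (fun=> a).
Proof. by exists 0%N; exact: poly_fun_of_degree_cst. Qed.

Lemma poly_fun_var i : poly_fun (fun x => x i).
Proof. by exists 1%N; exact: poly_fun_of_degree_var. Qed.

Lemma poly_funD f g : poly_fun f -> poly_fun g -> poly_fun (fun x => f x + g x).
Proof. by move=> [k fk] [l gl]; eexists; exact: poly_fun_of_degreeD fk gl. Qed.

Lemma poly_funM f g : poly_fun f -> poly_fun g -> poly_fun (fun x => f x * g x).
Proof. by move=> [k fk] [l gl]; eexists; exact: poly_fun_of_degreeM fk gl. Qed.

Lemma poly_funN f : poly_fun f -> poly_fun (fun x => - f x).
Proof.
move=> fp; apply: eq_poly_fun (poly_funM (poly_fun_cst (-1)) fp) => x.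
by rewrite mulN1r.
Qed.

Lemma poly_fun_sum (J : Type) (s : seq J) (P : pred J) (F : J -> (I -> C) -> C) :
  (forall j, poly_fun (F j)) -> poly_fun (fun x => \sum_(j <- s | P j) F j x).
Proof.
move=> Fp; elim: s => [|j s IHs].
  by apply: eq_poly_fun (poly_fun_cst 0) => x; rewrite big_nil.
have [Pj|nPj] := boolP (P j); last first.
  by apply: eq_poly_fun IHs => x; rewrite big_cons (negPf nPj).
by apply: eq_poly_fun (poly_funD (Fp j) IHs) => x; rewrite big_cons Pj.
Qed.

Lemma poly_fun_degree (J : finType) (F : J -> (I -> C) -> C) :
  (forall j, poly_fun (F j)) -> exists k, forall j, poly_fun_of_degree k (F j).
Proof.
move=> /choice[k Fk]; exists (\max_j k j) => j.
exact: poly_fun_of_degreeW (leq_bigmax j) (Fk j).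
Qed.

(** More polynomials than variables: the monomials in the [F j] of exponents
    less than [D] are more numerous than the monomials in the variables that occur in
    them, as the former number grows like [D ^ #|J|] and the latter like
    [D ^ #|I|]. *)
Lemma algebraically_dependent (J : finType) (F : J -> (I -> C) -> C) :
    (#|I| < #|J|)%N -> (forall j, poly_fun (F j)) ->
  exists D (c : {ffun J -> 'I_D} -> C),
    (exists m, c m != 0) /\ forall x, \sum_m c m * \prod_j F j x ^+ m j = 0.
Proof.
move=> IJ /poly_fun_degree[k Fk].
pose D := ((#|J| * k).+1 ^ #|I|).+1.
have FD (m : {ffun J -> 'I_D}) :
    poly_fun_of_degree (D.-1 * #|J| * k) (fun x => \prod_j F j x ^+ m j).
  apply: (poly_fun_of_degreeW _ (poly_fun_of_degree_prod (index_enum J) (fun j => m j) Fk)).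
  rewrite -big_distrl leq_mul2r /= mulnC -sum_nat_const; apply/orP; right.
  by apply: leq_sum => j _; rewrite -ltnS.
have /choice[coef coefE] := FD.
pose A := \matrix_(r < #|{ffun J -> 'I_D}|, s < #|{ffun I -> 'I_(D.-1 * #|J| * k).+1}|)
  coef (enum_val r) (enum_val s).
have rkA : (\rank A < #|{ffun J -> 'I_D}|)%N.
  apply: leq_ltn_trans (rank_leq_col _) _.
  rewrite !card_ffun !card_ord.
  apply: leq_trans (leq_pexp2l (isT : 0 < D)%N IJ).
  rewrite expnSr.
  apply: (@leq_ltn_trans (D ^ #|I| * (#|J| * k).+1 ^ #|I|)%N).
    rewrite -expnMn.
    have [-> //|I0] := posnP #|I|.
    rewrite leq_exp2r // -mulnA /D /=; lia.
  by rewrite ltn_pmul2l ?expn_gt0.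
have : kermx A != 0 by rewrite kermx_eq0 -row_leq_rank -ltnNge.
case/rowV0Pn => v /sub_kermxP vA /rV0Pn[r vr].
exists D, (fun m => v 0 (enum_rank m)); split.
  by exists (enum_val r); rewrite enum_valK.
move=> x.
under eq_bigr => m _ do rewrite coefE mulr_sumr.
rewrite exchange_big big1 //= => e _.
under eq_bigr do rewrite mulrA.
rewrite -mulr_suml [X in X * _](_ : _ = 0) ?mul0r //.
have vAe : \sum_j v 0 j * A j (enum_rank e) = 0.
  by have /matrixP/(_ 0 (enum_rank e)) := vA; rewrite !mxE.
rewrite -[RHS]vAe.
rewrite [RHS](reindex _ (onW_bij _ (@enum_rank_bij _))) /=.
by apply: eq_bigr => m _; rewrite mxE !enum_rankK.
Qed.

End AlgebraicDependence.

(** * Unimodular simplices *)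

Section UnimodularSimplex.
Context {R : realType} {d : nat}.
Implicit Types (v : 'I_4 -> lattice_pt d) (p w x y : 'rV[R]_3) (i : lattice_pt d).

Definition dotv p x : R := \sum_j p 0 j * x 0 j.

Lemma dotvDr p x y : dotv p (x + y) = dotv p x + dotv p y.
Proof. by rewrite -big_split; apply: eq_bigr => j _; rewrite mxE mulrDr. Qed.

Lemma dotvZr p (c : R) x : dotv p (c *: x) = c * dotv p x.
Proof. by rewrite mulr_sumr; apply: eq_bigr => j _; rewrite mxE mulrCA. Qed.

Lemma dotv_suml (I : finType) (c : I -> R) (p : I -> 'rV[R]_3) x :
  dotv (\sum_i c i *: p i) x = \sum_i c i * dotv (p i) x.
Proof.
under [RHS]eq_bigr do rewrite mulr_sumr.
rewrite exchange_big; apply: eq_bigr => j _ /=.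
by rewrite summxE mulr_suml; apply: eq_bigr => i _; rewrite mxE mulrA.
Qed.

Definition edge_mx v : 'M[int]_3 :=
  \matrix_(k, j) (pt_vec int (v (lift ord0 k)) 0 j - pt_vec int (v ord0) 0 j).

Definition unimodular v : Prop := `|\det (edge_mx v)| = 1.

Lemma edge_mx_unit v : unimodular v -> edge_mx v \in unitmx.
Proof.
by rewrite /unimodular unitmxE => /eqP; rewrite eqr_norml // => /andP[/orP[]/eqP-> _].
Qed.

Lemma pt_vec_intr (S : pzRingType) i : pt_vec S i = map_mx intr (pt_vec int i).
Proof. by apply/rowP => j; rewrite !mxE natz. Qed.

Lemma pt_vec_inj (S : numDomainType) : injective (@pt_vec S d).
Proof.
move=> i k /rowP ik; apply/val_inj/ffunP => j; apply/val_inj => /=.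
by apply/eqP; rewrite -(eqr_nat S); have := ik j; rewrite !mxE => ->.
Qed.

(** A linear form takes arbitrary values on the vertices of a unimodular
    simplex, up to a common additive constant. *)
Lemma unimodular_affine v (c : 'I_4 -> R) : unimodular v ->
  exists w (m : R), forall k, dotv (pt_vec R (v k)) w = c k + m.
Proof.
move=> /edge_mx_unit vu.
pose y : 'cV[R]_3 := \col_r (c (lift ord0 r) - c ord0).
pose u := map_mx intr (invmx (edge_mx v)) *m y.
have Eu : map_mx intr (edge_mx v) *m u = y.
  by rewrite mulmxA -map_mxM mulmxV // map_mx1 mul1mx.
exists u^T, (dotv (pt_vec R (v ord0)) u^T - c ord0) => k.
have [[r ->]|->] : (exists r, k = lift ord0 r) \/ k = ord0; last by rewrite addrC subrK.
  by case: (unliftP ord0 k) => [r ->|->]; [left; exists r|right].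
apply/eqP; rewrite addrA -addrAC -subr_eq; apply/eqP.
have /colP/(_ r) := Eu; rewrite [RHS]mxE => <-; rewrite mxE -sumrB.
by apply: eq_bigr => j _; rewrite !mxE rmorphB /= !natz -!pmulrn mulrBl.
Qed.

(** The ring is arbitrary because the coordinates of lattice points have to be
    found over the integers. *)
Lemma barycentric (S : comNzRingType) v (p : 'rV[S]_3) : unimodular v ->
  exists2 l : 'I_4 -> S, \sum_k l k = 1 & p = \sum_k l k *: pt_vec S (v k).
Proof.
move=> /edge_mx_unit vu.
pose E : 'M[S]_3 := map_mx intr (edge_mx v).
pose l : 'rV[S]_3 := (p - pt_vec S (v ord0)) *m map_mx intr (invmx (edge_mx v)).
have lE : l *m E = p - pt_vec S (v ord0).
  by rewrite -mulmxA -map_mxM mulVmx // map_mx1 mulmx1.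
exists (fun k => if unlift ord0 k is Some r then l 0 r else 1 - \sum_r l 0 r).
  rewrite big_ord_recl unlift_none /=.
  by under [X in _ + X]eq_bigr do rewrite liftK; rewrite subrK.
rewrite big_ord_recl unlift_none /=.
under [X in _ + X]eq_bigr do rewrite liftK.
rewrite scalerBl scale1r scaler_suml addrAC -addrA -sumrB.
apply/eqP; rewrite addrC -subr_eq -lE; apply/eqP.
rewrite mulmx_sum_row; apply: eq_bigr => r _; rewrite -scalerBr; congr (_ *: _).
by apply/rowP => j; rewrite !mxE rmorphB /= !natz.
Qed.

(** An affine form that is [1] at the vertex [k] and [0] at the others
    recovers the coordinate [k]. *)
Lemma barycentric_unique v (l l' : 'I_4 -> R) : unimodular v ->
    \sum_k l k = 1 -> \sum_k l' k = 1 ->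
    \sum_k l k *: pt_vec R (v k) = \sum_k l' k *: pt_vec R (v k) ->
  l =1 l'.
Proof.
move=> vu l1 l'1 ll' k.
have [w [m wE]] := unimodular_affine (fun r => (r == k)%:R) vu.
have coordE (h : 'I_4 -> R) : \sum_r h r = 1 ->
    dotv (\sum_r h r *: pt_vec R (v r)) w = h k + m.
  move=> h1; rewrite dotv_suml; under eq_bigr do rewrite wE mulrDr.
  rewrite big_split /= -mulr_suml h1 mul1r (bigD1 k) //= eqxx mulr1 big1 ?addr0 //.
  by move=> r /negPf ->; rewrite mulr0.
by apply: (addIr m); rewrite -!coordE // ll'.
Qed.

Lemma unimodular_inj v : unimodular v -> injective v.
Proof.
move=> vu k r vkr; apply/eqP; apply: contraT => kr.
have [w [m wE]] := unimodular_affine (fun r => (r == k)%:R) vu.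
have := wE k; rewrite vkr wE eqxx eq_sym (negPf kr) => /addIr/eqP.
by rewrite eq_sym oner_eq0.
Qed.

(** The barycentric coordinates of a lattice point are integers; nonnegative
    integers of sum [1] are the coordinates of a vertex. *)
Lemma lattice_pt_in_simplex v (l : 'I_4 -> R) i : unimodular v ->
    (forall k, 0 <= l k) -> \sum_k l k = 1 ->
    pt_vec R i = \sum_k l k *: pt_vec R (v k) ->
  exists k, i = v k.
Proof.
move=> vu l0 l1 iE.
have [z z1 zE] := barycentric (pt_vec int i) vu.
have lz k : l k = (z k)%:~R.
  apply: (barycentric_unique (l' := fun r => (z r)%:~R) vu l1); first by rewrite -rmorph_sum z1.
  rewrite -iE pt_vec_intr zE; apply/rowP => j; rewrite !mxE !summxE rmorph_sum /=.
  by apply: eq_bigr => r _; rewrite !mxE rmorphM /= natz -pmulrn.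
have z0 k : 0 <= z k by have := l0 k; rewrite lz ler0z.
have /existsP[k zk] : [exists k, z k != 0].
  apply: contraPT z1 => /existsPn z00; rewrite big1 // => k _.
  by have := z00 k; rewrite negbK => /eqP.
exists k; apply: (@pt_vec_inj int).
have zk1 : 1 <= z k by rewrite -[1]add0r lezD1 lt_def zk z0.
have zr r : r != k -> z r = 0.
  move=> rk; apply/eqP; move: z1; rewrite (bigD1 k) //= (bigD1 r) //=.
  have : 0 <= \sum_(s | (s != k) && (s != r)) z s by apply: sumr_ge0.
  have := z0 r; move: (\sum_(_ | _) _) (z r) (z k) zk1 => a b c; lia.
rewrite zE (bigD1 k) //= big1 ?addr0 => [|r /zr ->]; last by rewrite scale0r.
suff -> : z k = 1 by rewrite scale1r.
by move: z1; rewrite (bigD1 k) //= big1 ?addr0 // => r /zr.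
Qed.

End UnimodularSimplex.

(** * Cells of the dual subdivision *)

Lemma small_scale {R : realFieldType} (I : finType) (P : pred I) (g h : I -> R) :
    (forall i, P i -> 0 < g i) ->
  exists2 s : R, 0 < s & forall i, P i -> s * h i < g i.
Proof.
move=> g0; pose S := \sum_(i | P i) (1 + `|h i|) / g i.
have S0 : 0 <= S.
  by apply: sumr_ge0 => i /g0 gi; rewrite divr_ge0 ?addr_ge0 // ltW.
have S1 : 0 < 1 + S by rewrite ltr_wpDr.
exists (1 + S)^-1 => [|i Pi]; first by rewrite invr_gt0.
rewrite mulrC ltr_pdivrMr // mulrC -ltr_pdivrMr ?g0 //.
apply: (@le_lt_trans _ _ S); last by rewrite ltrDr.
rewrite /S (bigD1 i) //= -[leLHS]addr0 lerD //.
  rewrite ler_pM2r ?invr_gt0 ?g0 //.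
  by rewrite (le_trans (ler_norm _)) // lerDr.
by apply: sumr_ge0 => j /andP[/g0 gj _]; rewrite divr_ge0 ?addr_ge0 // ltW.
Qed.

Section DualSubdivision.
Context {R : realType} {d : nat}.
Implicit Types (a : lattice_pt d -> R) (v : 'I_4 -> lattice_pt d).
Implicit Types (p w x y z : 'rV[R]_3) (i j : lattice_pt d).
Implicit Types (A B F : {set lattice_pt d}) (T : {set {set lattice_pt d}}).

Lemma lattice_pt0_proof : (\sum_j ([ffun=> ord0] : {ffun 'I_3 -> 'I_d.+1}) j <= d)%N.
Proof. by rewrite big1 // => j _; rewrite ffunE. Qed.

Definition lattice_pt0 : lattice_pt d :=
  exist _ [ffun=> ord0] lattice_pt0_proof.

Definition trop_poly a x : R :=
  trop_term a x [arg max_(i > lattice_pt0) trop_term a x i]%O.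

Lemma trop_term_le a x i : trop_term a x i <= trop_poly a x.
Proof. by rewrite /trop_poly; case: arg_maxP => // j _; apply. Qed.

Lemma mem_argmax a x i :
  (i \in argmax_set a x) = (trop_term a x i == trop_poly a x).
Proof.
rewrite inE; apply/forallP/eqP => [ix|-> j]; last exact: trop_term_le.
by apply/eqP; rewrite eq_le trop_term_le /= ix.
Qed.

Lemma trop_term_lt a x i :
  i \notin argmax_set a x -> trop_term a x i < trop_poly a x.
Proof. by rewrite mem_argmax lt_neqAle => ->; exact: trop_term_le. Qed.

Lemma argmax_set_nonempty a x : exists i, i \in argmax_set a x.
Proof. by exists [arg max_(i > lattice_pt0) trop_term a x i]%O; rewrite mem_argmax. Qed.

Lemma argmax_setE a x A (m : R) : (exists i, i \in A) ->
    (forall i, i \in A -> trop_term a x i = m) ->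
    (forall i, i \notin A -> trop_term a x i < m) ->
  argmax_set a x = A.
Proof.
move=> [i0 i0A] Am nAm.
have le_m i : trop_term a x i <= m.
  by have [/Am->//|/nAm/ltW] := boolP (i \in A).
apply/setP => i; rewrite inE; apply/forallP/idP => [ix|/Am-> //].
apply: contraT => /nAm; rewrite ltNge => /negP; elim.
by rewrite -(Am _ i0A).
Qed.

Lemma trop_termDr a x y i : trop_term a (x + y) i = trop_term a x i + dotv (pt_vec R i) y.
Proof. by rewrite /trop_term -!/(dotv _ _) dotvDr addrA. Qed.

Lemma trop_termE a x i : trop_term a x i = a i + dotv (pt_vec R i) x.
Proof. by []. Qed.

(** Moving the dual point in the direction on which the linear forms of the
    vertices in [F] win by [1] over those of the other vertices. *)
Lemma face_of_cell a y v F : unimodular v ->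
    argmax_set a y = [set v k | k : 'I_4] -> (exists i, i \in F) ->
    F \subset [set v k | k : 'I_4] ->
  exists x, argmax_set a x = F.
Proof.
move=> vu yB F0 FB.
have [w [m wE]] := unimodular_affine (fun k => if v k \in F then 0 else -1 : R) vu.
have [|s s0 sB] := @small_scale _ _ (fun i => i \notin argmax_set a y)
  (fun i => trop_poly a y - trop_term a y i) (fun i => dotv (pt_vec R i) w - m).
  by move=> i /trop_term_lt; rewrite subr_gt0.
exists (y + s *: w); apply: (@argmax_setE _ _ _ (trop_poly a y + s * m)) => // i iF.
  have := fintype.subsetP FB _ iF; rewrite trop_termDr dotvZr -yB mem_argmax => /eqP->.
  have /imsetP[k _ iE] := fintype.subsetP FB _ iF.
  by rewrite iE wE -iE iF add0r.
have [iB|iB] := boolP (i \in argmax_set a y); last first.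
  by have := sB _ iB; rewrite trop_termDr dotvZr; nra.
have := iB; rewrite mem_argmax => /eqP iy; rewrite trop_termDr dotvZr iy.
move: iB; rewrite yB => /imsetP[k _ iE].
by rewrite iE wE -iE (negPf iF); nra.
Qed.

Definition maximal_cell T B : Prop :=
  B \in T /\ forall B', B' \in T -> B \subset B' -> B' = B.

Lemma maximal_cell_exists T A : A \in T ->
  exists2 B, maximal_cell T B & A \subset B.
Proof.
move=> AT; have [B /maxsetP[BT Bmax] AB] := @maxset_exists _ (mem T) A AT.
by exists B => //; split => // B' /Bmax/[apply].
Qed.

Lemma dual_subdivisionP a A :
  reflect (exists x, argmax_set a x = A) (A \in dual_subdivision a).
Proof.
rewrite inE; apply: (iffP idP) => [/asboolP[x ->]|[x <-]]; first by exists x.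
by apply/asboolP; exists x.
Qed.

Lemma primitive_cell T B : primitive_triangulation T -> maximal_cell T B ->
  exists2 v, unimodular v & B = [set v k | k : 'I_4].
Proof. by move=> Tp [BT Bmax]; have [v [-> vu]] := Tp _ BT Bmax; exists v. Qed.

(** All maximal cells have barycentric coordinates for [p]; if some coordinate of
    [p] is negative, crossing the facet opposite to that vertex leads to another
    maximal cell. This strictly lowers the height over [p] of the affine function
    dual to the cell, so that a cell of minimal height contains [p]. *)
Lemma covering a p (c : lattice_pt d -> R) :
    primitive_triangulation (dual_subdivision a) ->
    (forall i, 0 <= c i) -> \sum_i c i = 1 -> p = \sum_i c i *: pt_vec R i ->
  exists v (l : 'I_4 -> R),
    [/\ unimodular v, maximal_cell (dual_subdivision a) [set v k | k : 'I_4],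
        forall k, 0 <= l k, \sum_k l k = 1 & p = \sum_k l k *: pt_vec R (v k)].
Proof.
move=> Tp c0 c1 pE; set T := dual_subdivision a.
pose height y := trop_poly a y - dotv p y.
have [Y YE] : exists Y : {set lattice_pt d} -> 'rV[R]_3,
    forall A, A \in T -> argmax_set a (Y A) = A.
  suff /choice[Y YE] : forall A, exists y, A \in T -> argmax_set a y = A by exists Y.
  move=> A.
  have [/dual_subdivisionP[x xA]|] := boolP (A \in T); first by exists x.
  by exists 0.
have [A0 A0T] : exists A, A \in T.
  by exists (argmax_set a 0); apply/dual_subdivisionP; exists 0.
have [B0 B0max _] := maximal_cell_exists A0T.
pose B := [arg min_(A < B0 | `[< maximal_cell T A >]) height (Y A)]%O.
have [Bmax Bmin] : maximal_cell T B /\ forall B', maximal_cell T B' ->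
    height (Y B) <= height (Y B').
  rewrite /B; case: arg_minP => [|B1 /asboolP B1max B1min]; first exact/asboolP.
  by split=> // B' B'max; apply: B1min; apply/asboolP.
have [v vu BE] := primitive_cell Tp Bmax.
have [l l1 lE] := barycentric p vu.
have YB := YE _ Bmax.1.
exists v, l; split; rewrite -?BE //.
move=> r; rewrite leNgt; apply/negP => lr.
(* Along [w] the vertices of the facet opposite to [v r] tie. *)
have [w [m wE]] := unimodular_affine (fun k => if k == r then -1 else 0 : R) vu.
have pw : dotv p w = m - l r.
  rewrite lE dotv_suml; under eq_bigr do rewrite wE mulrDr.
  rewrite big_split /= -mulr_suml l1 mul1r (bigD1 r) //= eqxx mulrN1.
  rewrite big1 ?addr0 1?addrC // => k /negPf ->; exact: mulr0.
pose K i := m < dotv (pt_vec R i) w.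
have [i1 Ki1] : exists i, K i.
  apply/existsP; apply: contraT => /existsPn Km.
  have : dotv p w <= m.
    rewrite pE dotv_suml -[leRHS]mul1r -c1 mulr_suml.
    by apply: ler_sum => i _; rewrite ler_wpM2l // leNgt Km.
  by rewrite pw; lra.
set y := Y B in YB.
pose step i := (trop_poly a y - trop_term a y i) / (dotv (pt_vec R i) w - m).
(* The first term that catches up with those of the facet when the dual point
   moves from [y] in the direction [w]. *)
pose q := [arg min_(i < i1 | K i) step i]%O.
have [Kq qmin] : K q /\ forall i, K i -> step q <= step i.
  by rewrite /q; case: arg_minP => // i Ki imin; split=> // j /imin.
have K_out i : K i -> i \notin B.
  rewrite BE; apply: contraL => /imsetP[k _ ->].
  by rewrite /K wE; case: eqP => _; rewrite ltNge; apply/negPn; lra.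
have step0 : 0 < step q.
  by rewrite divr_gt0 ?subr_gt0 // trop_term_lt // YB K_out.
pose z := y + step q *: w.
have zle i : trop_term a z i <= trop_poly a y + step q * m.
  rewrite trop_termDr dotvZr.
  have [Ki|Ki] := boolP (K i); last first.
    have := trop_term_le a y i; move: Ki; rewrite /K -leNgt => Ki iy.
    by rewrite lerD // ler_wpM2l // ltW.
  have := qmin _ Ki; rewrite {2}/step ler_pdivlMr ?subr_gt0 //; lra.
have zq : trop_term a z q = trop_poly a y + step q * m.
  rewrite trop_termDr dotvZr.
  have : step q * (dotv (pt_vec R q) w - m) = trop_poly a y - trop_term a y q.
    by rewrite divfK // gt_eqF // subr_gt0.
  lra.
have zpoly : trop_poly a z = trop_poly a y + step q * m.
  by apply/eqP; rewrite eq_le -{2}zq trop_term_le andbT zle.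
have zv k : k != r -> v k \in argmax_set a z.
  move=> kr; rewrite mem_argmax zpoly trop_termDr dotvZr wE (negPf kr) add0r.
  rewrite (inj_eq (addIr _)) -mem_argmax YB BE; exact: imset_f.
have [B' B'max zB'] : exists2 B', maximal_cell T B' & argmax_set a z \subset B'.
  by apply: maximal_cell_exists; apply/dual_subdivisionP; exists z.
have [v' v'u B'E] := primitive_cell Tp B'max.
have cardB' : (#|B'| <= 4)%N.
  by rewrite B'E -[leqRHS]card_ord leq_imset_card.
have z4 : (4 <= #|argmax_set a z|)%N.
  have sub : q |: (v @: [set~ r]%SET) \subset argmax_set a z.
    rewrite finset.subUset finset.sub1set mem_argmax zq zpoly eqxx /=.
    by apply/fintype.subsetP => _ /imsetP[k + ->]; rewrite finset.in_setC1 => /zv.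
  apply: leq_trans (subset_leq_card sub).
  rewrite cardsU1 card_imset ?cardsC1 ?card_ord; last exact: unimodular_inj vu.
  suff -> : q \notin v @: [set~ r]%SET by [].
  apply: contra (K_out _ Kq) => /imsetP[k _ ->]; rewrite BE; exact: imset_f.
have zE : argmax_set a z = B'.
  by apply/eqP; rewrite eqEcard zB' (leq_trans cardB').
have := Bmin _ B'max; rewrite leNgt => /negP; apply.
have YB' := YE _ B'max.1.
have -> : height (Y B') = height z.
  have [l' l'1 l'E] := barycentric p v'u.
  have heightE x : argmax_set a x = B' -> height x = \sum_k l' k * a (v' k).
    move=> xE; rewrite /height l'E dotv_suml -[trop_poly a x]mul1r -l'1 mulr_suml -sumrB.
    apply: eq_bigr => k _; rewrite -mulrBr; congr (_ * _).
    have : v' k \in argmax_set a x by rewrite xE B'E imset_f.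
    by rewrite mem_argmax trop_termE => /eqP <-; rewrite addrK.
  by rewrite !heightE.
rewrite /height zpoly dotvDr dotvZr pw.
have := step0; nra.
Qed.

End DualSubdivision.

(** * The dual graph is connected *)

Lemma continuous_bigmax {R : realType} (I : Type) (r : seq I) (P : pred I)
    (f0 : R -> R) (f : I -> R -> R) :
    continuous f0 -> (forall i, continuous (f i)) ->
  continuous (fun s => \big[Num.max/f0 s]_(i <- r | P i) f i s).
Proof.
move=> f0c fc; elim: r => [|i r IHr].
  by under eq_fun do rewrite big_nil.
have [Pi|nPi] := boolP (P i); last first.
  by under eq_fun do rewrite big_cons (negPf nPi).
under eq_fun do rewrite big_cons Pi.
by move=> s; apply: continuous_max; [exact: fc|exact: IHr].
Qed.

Section Connectedness.
Context {R : realType} {d : nat} (a : lattice_pt d -> R).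
Hypothesis Tprim : primitive_triangulation (dual_subdivision a).
Implicit Types (x y : 'rV[R]_3) (i j : lattice_pt d).

Lemma lattice_pt_in_cell i : exists x, i \in argmax_set a x.
Proof.
have [|||v [l [vu [vT _] l0 l1 iE]]] := @covering R d a (pt_vec R i) (fun j => (j == i)%:R) Tprim.
- by move=> j; exact: ler0n.
- by rewrite (bigD1 i) //= eqxx big1 ?addr0 // => j /negPf ->.
- rewrite (bigD1 i) //= eqxx scale1r big1 ?addr0 // => j /negPf ->.
  by rewrite scale0r.
have [k ->] := lattice_pt_in_simplex vu l0 l1 iE.
have /dual_subdivisionP[x xE] := vT; exists x; rewrite xE; exact: imset_f.
Qed.

(** On a segment from a point dual to [i0] to one dual to a lattice point outside
    [I], the maximum of the terms in [I] and the maximum of the others meet. The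
    two terms that realise them there belong to a common simplex, whose edges are
    cells. *)
Lemma edge_connected (I : {set lattice_pt d}) i0 : i0 \in I ->
    (forall i j x, argmax_set a x = [set i; j]%SET -> i \in I -> j \in I) ->
  forall j, j \in I.
Proof.
move=> i0I Iclosed j0; apply: contraT => j0I.
have [x0 i0x0] := lattice_pt_in_cell i0.
have [x1 j0x1] := lattice_pt_in_cell j0.
pose x (s : R) := x0 + s *: (x1 - x0).
have x_0 : x 0 = x0 by rewrite /x scale0r addr0.
have x_1 : x 1 = x1 by rewrite /x scale1r addrC subrK.
have xc i : continuous (fun s => trop_term a (x s) i).
  move=> s; rewrite /x; under eq_fun do rewrite trop_termDr dotvZr.
  by apply: cvgD; [exact: cvg_cst|apply: cvgMr_tmp; exact: cvg_id].
pose M (P : pred (lattice_pt d)) i s :=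
  \big[Num.max/trop_term a (x s) i]_(j | P j) trop_term a (x s) j.
have Mc P i : continuous (M P i) by apply: continuous_bigmax.
have Mge (P : pred _) i j s : P j -> trop_term a (x s) j <= M P i s.
  by move=> Pj; exact: le_bigmax_cond.
have Mpoly (P : pred _) i s : M P i s <= trop_poly a (x s).
  by apply/bigmax_leP; split => [|j _]; exact: trop_term_le.
have Mterm (P : pred _) i s : P i -> exists2 j, P j & M P i s = trop_term a (x s) j.
  move=> Pi; apply: (big_ind (fun r => exists2 j, P j & r = trop_term a (x s) j)).
  - by exists i.
  - by move=> r r' rP r'P; rewrite maxEle; case: ifP.
  - by move=> j Pj; exists j.
have [s _ sE] : exists2 s, s \in `[0, 1] &
    M (mem I) i0 s - M (fun i => i \notin I) j0 s = 0.
  apply: IVT => //.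
    apply: continuous_subspaceT => s; apply: cvgB; exact: Mc.
  have g0 : 0 <= M (mem I) i0 0 - M (fun i => i \notin I) j0 0.
    rewrite subr_ge0 (le_trans (Mpoly _ _ _)) //.
    by move: i0x0; rewrite -x_0 mem_argmax => /eqP <-; exact: Mge.
  have g1 : M (mem I) i0 1 - M (fun i => i \notin I) j0 1 <= 0.
    rewrite subr_le0 (le_trans (Mpoly _ _ _)) //.
    by move: j0x1; rewrite -x_1 mem_argmax => /eqP <-; exact: Mge.
  by rewrite ge_min le_max g0 g1 orbT.
have [i iI iE] := Mterm (mem I) i0 s i0I.
have [j jI jE] := Mterm (fun i => i \notin I) j0 s j0I.
have ij : trop_term a (x s) i = trop_term a (x s) j by lra.
have ipoly : trop_term a (x s) i = trop_poly a (x s).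
  have [k kx] := argmax_set_nonempty a (x s).
  apply/eqP; rewrite eq_le trop_term_le /=; move: kx; rewrite mem_argmax => /eqP <-.
  have [kI|kI] := boolP (k \in I); first by rewrite -iE Mge.
  by rewrite ij -jE Mge.
have [B Bmax sB] : exists2 B, maximal_cell (dual_subdivision a) B &
    argmax_set a (x s) \subset B.
  by apply: maximal_cell_exists; apply/dual_subdivisionP; exists (x s).
have [v vu BE] := primitive_cell Tprim Bmax.
have /dual_subdivisionP[y yB] := Bmax.1.
have [|||z zE] := @face_of_cell R d a y v [set i; j]%SET vu.
- by rewrite yB.
- by exists i; rewrite !inE eqxx.
- rewrite -BE; apply/fintype.subsetP => k kij; apply: (fintype.subsetP sB).
  by move: kij; rewrite in_set2 mem_argmax => /orP[] /eqP ->; rewrite -?ij ipoly.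
by move: jI; rewrite (Iclosed i j z zE iI).
Qed.

End Connectedness.

(** * Genericity *)

Lemma cvg_sumr {R : realType} {X : Type} (F : set_system X) {FF : Filter F}
    (J : finType) (f : J -> X -> R) (l : J -> R) :
  (forall j, f j x @[x --> F] --> l j) ->
  \sum_j f j x @[x --> F] --> \sum_j l j.
Proof.
move=> fl; elim: (index_enum J) => [|j r IHr].
  rewrite big_nil; under eq_fun do rewrite big_nil; exact: cvg_cst.
by rewrite big_cons; under eq_fun do rewrite big_cons; exact: cvgD.
Qed.

Section ConeOpen.
Context {R : realType} {d : nat}.
Implicit Types (a : lattice_pt d -> R) (T : {set {set lattice_pt d}}).

(** Each cell [A] of [a] is contained in a cell of [a0], one that contains the
    barycentre of [A] in its convex hull: the two cells give the same value of the
    concave envelope of [a] at that point, so that the affine function dual to the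
    second one is tight on [A]. *)
Lemma dual_subdivision_eq a0 a :
    primitive_triangulation (dual_subdivision a0) ->
    (forall B, maximal_cell (dual_subdivision a0) B -> B \in dual_subdivision a) ->
  dual_subdivision a = dual_subdivision a0.
Proof.
move=> Tp Ba; apply/eqP; rewrite finset.eqEsubset; apply/andP; split; last first.
  apply/fintype.subsetP => A AT; have [B Bmax AB] := maximal_cell_exists AT.
  have [v vu BE] := primitive_cell Tp Bmax.
  have /dual_subdivisionP[y yB] := Ba _ Bmax.
  apply/dual_subdivisionP; apply: (face_of_cell vu (a := a) (y := y)).
  - by rewrite yB.
  - by have /dual_subdivisionP[x <-] := AT; exact: argmax_set_nonempty.
  - by rewrite -BE.
apply/fintype.subsetP => A /dual_subdivisionP[x xA].
have A0 : (0 < #|A|)%N.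
  by apply/card_gt0P; rewrite -xA; exact: argmax_set_nonempty.
pose c (i : lattice_pt d) : R := if i \in A then #|A|%:R^-1 else 0.
have c0 i : 0 <= c i by rewrite /c; case: ifP => // _; rewrite invr_ge0 ler0n.
have c1 : \sum_i c i = 1.
  rewrite /c -big_mkcond sumr_const -(mulr_natr _^-1) mulVf //.
  by rewrite pnatr_eq0 -lt0n.
(* The cell [B] of [a0] over the barycentre [p] of [A]. *)
have [v [l [vu Bmax l0 l1 pE]]] := covering Tp c0 c1 erefl.
set p := \sum_i _ in pE.
have /dual_subdivisionP[y yB] := Ba _ Bmax.
have ck z : \sum_i c i * trop_term a z i = \sum_i c i * a i + dotv p z.
  by rewrite dotv_suml -big_split /=; apply: eq_bigr => i _; rewrite -mulrDr.
have lk z : \sum_k l k * trop_term a z (v k) = \sum_k l k * a (v k) + dotv p z.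
  by rewrite pE dotv_suml -big_split /=; apply: eq_bigr => k _; rewrite -mulrDr.
have cx : \sum_i c i * trop_term a x i = trop_poly a x.
  rewrite -[RHS]mul1r -c1 mulr_suml; apply: eq_bigr => i _; rewrite /c.
  case: ifP => [|_]; last by rewrite !mul0r.
  by rewrite -xA mem_argmax => /eqP ->.
have lx : \sum_k l k * trop_term a x (v k) <= trop_poly a x.
  rewrite -[leRHS]mul1r -l1 mulr_suml; apply: ler_sum => k _.
  by rewrite ler_wpM2l // trop_term_le.
have ly : \sum_k l k * trop_term a y (v k) = trop_poly a y.
  rewrite -[RHS]mul1r -l1 mulr_suml; apply: eq_bigr => k _; congr (_ * _).
  by apply/eqP; rewrite -mem_argmax yB imset_f.
have AB : A \subset [set v k | k : 'I_4].
  apply/fintype.subsetP => i iA; rewrite -yB mem_argmax.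
  have gap0 j : 0 <= c j * (trop_poly a y - trop_term a y j).
    by rewrite mulr_ge0 // subr_ge0 trop_term_le.
  have : \sum_j c j * (trop_poly a y - trop_term a y j) <= 0.
    under eq_bigr do rewrite mulrBr.
    rewrite sumrB -mulr_suml c1 mul1r ck -ly lk.
    by move: lx; rewrite lk -cx ck; lra.
  rewrite (bigD1 i) //= => sum_le0.
  have : c i * (trop_poly a y - trop_term a y i) <= 0.
    by apply: le_trans sum_le0; rewrite lerDl sumr_ge0.
  rewrite pmulr_rle0; last by rewrite /c iA invr_gt0 ltr0n.
  by rewrite subr_le0 eq_le trop_term_le => ->.
have /dual_subdivisionP[z zB] := Bmax.1.
apply/dual_subdivisionP; apply: (face_of_cell vu (a := a0) (y := z)) => //.
by rewrite -xA; exact: argmax_set_nonempty.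
Qed.

Lemma linear_form_continuous (J : finType) (c : J -> R) (f : J -> lattice_pt d) :
  continuous (fun a : {ptws lattice_pt d -> R} => \sum_j c j * a (f j)).
Proof.
move=> a; apply: (@cvg_sumr R _ (nbhs a) _ J (fun j b => c j * b (f j))) => j.
have fc : (fun b : {ptws lattice_pt d -> R} => b (f j)) @ nbhs a --> (a (f j) : R).
  exact: (@proj_continuous (lattice_pt d) (fun=> R) (f j) a).
exact: (@cvgMl_tmp R _ (nbhs a) _ (fun b => b (f j)) (c j) _ fc).
Qed.

(** The dual point of a maximal cell depends linearly on the coefficients, so
    that finitely many strict linear inequalities keep it a cell. *)
Lemma cone_of_open T a : primitive_triangulation T -> cone_of T a ->
  \forall a' \near (a : {ptws lattice_pt d -> R}), cone_of T a'.
Proof.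
move=> Tp aT; rewrite /cone_of /= in aT; rewrite -aT in Tp.
have Fa : Filter (nbhs (a : {ptws lattice_pt d -> R})) by exact: nbhs_filter.
have : \forall a' \near (a : {ptws lattice_pt d -> R}),
    forall B, maximal_cell (dual_subdivision a) B -> B \in dual_subdivision a'.
  apply: (@filter_forall _ _ (fun B a' =>
    maximal_cell (dual_subdivision a) B -> B \in dual_subdivision a') _ Fa) => B.
  have [Bmax|nB] := pselect (maximal_cell (dual_subdivision a) B); last first.
    by near=> a' => /nB.
  have [v vu BE] := primitive_cell Tp Bmax.
  have /dual_subdivisionP[y yB] := Bmax.1.
  have /choice[l lP] (i : lattice_pt d) : exists l : 'I_4 -> R,
      \sum_k l k = 1 /\ pt_vec R i = \sum_k l k *: pt_vec R (v k).
    by have [l l1 lE] := barycentric (pt_vec R i) vu; exists l.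
  have : \forall a' \near (a : {ptws lattice_pt d -> R}),
      forall i, i \notin B -> a' i < \sum_k l i k * a' (v k).
    apply: (@filter_forall _ _ (fun i a' =>
      i \notin B -> a' i < \sum_k l i k * a' (v k)) _ Fa) => i.
    have [iB|iB] := boolP (i \in B); first by near=> a'.
    have [l1 iE] := lP i.
    have ai : 0 < \sum_k l i k * a (v k) - \sum_(k < 1) 1 * a i.
      have := iB; rewrite -{1}yB => /trop_term_lt.
      rewrite big_ord1 mul1r trop_termE iE dotv_suml -[trop_poly a y]mul1r -l1 mulr_suml.
      rewrite subr_gt0 -ltrBrDr -sumrB; under eq_bigr => k _.
        rewrite -mulrBr (_ : _ - _ = a (v k)); first over.
        have : v k \in argmax_set a y by rewrite yB BE imset_f.
        by rewrite mem_argmax trop_termE => /eqP <-; rewrite addrK.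
      by [].
    have : \forall a' \near (a : {ptws lattice_pt d -> R}),
      0 < \sum_k l i k * a' (v k) - \sum_(k < 1) 1 * a' i.
      have kc := @linear_form_continuous _ (l i) v a.
      have ic := @linear_form_continuous _ (fun _ : 'I_1 => 1) (fun=> i) a.
      exact: (@cvgr_gt _ _ _ Fa _ _ (cvgB kc ic) _ ai).
    by apply: (@filterS _ _ Fa) => a'; rewrite big_ord1 mul1r subr_gt0.
  apply: (@filterS _ _ Fa) => a' a'B _.
  have [w [m wE]] := unimodular_affine (fun k => - a' (v k)) vu.
  apply/dual_subdivisionP; exists w; apply: (@argmax_setE _ _ _ _ _ m).
  - by exists (v ord0); rewrite BE imset_f.
  - by rewrite BE => _ /imsetP[k _ ->]; rewrite trop_termE wE addrA subrr add0r.
  - move=> i iB; rewrite trop_termE; have [l1 iE] := lP i.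
    rewrite iE dotv_suml; under eq_bigr do rewrite wE mulrDr mulrN.
    by rewrite big_split /= sumrN -mulr_suml l1 mul1r addrA gtrDr subr_lt0 a'B.
by apply: (@filterS _ _ Fa) => a' a'B; rewrite /cone_of /= -aT; exact: dual_subdivision_eq.
Unshelve. all: by end_near.
Qed.
End ConeOpen.

Section Generic.
Context {R : realType} {d : nat}.
Implicit Types (a : lattice_pt d -> R) (T : {set {set lattice_pt d}}).

(** No two monomials of degree less than [D] in each coefficient have the same
    tropical value. *)
Definition generic_coeffs D a : Prop :=
  injective (fun u : {ffun lattice_pt d -> 'I_D} => \sum_i (u i)%:R * a i).

Lemma generic_coeffs_open D a : generic_coeffs D a ->
  \forall a' \near (a : {ptws lattice_pt d -> R}), generic_coeffs D a'.
Proof.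
move=> ainj.
have Fa : Filter (nbhs (a : {ptws lattice_pt d -> R})) by exact: nbhs_filter.
suff : \forall a' \near (a : {ptws lattice_pt d -> R}),
    forall uu : {ffun lattice_pt d -> 'I_D} * {ffun lattice_pt d -> 'I_D},
    uu.1 != uu.2 -> \sum_i (uu.1 i)%:R * a' i - \sum_i (uu.2 i)%:R * a' i != 0.
  apply: (@filterS _ _ Fa) => a' a'inj u u' /eqP; rewrite -subr_eq0 => uu'.
  by apply/eqP; apply: contraTT uu' => /(a'inj (u, u')).
apply: (@filter_forall _ _ (fun (uu : {ffun lattice_pt d -> 'I_D} * {ffun lattice_pt d -> 'I_D}) a' => uu.1 != uu.2 ->
  \sum_i (uu.1 i)%:R * a' i - \sum_i (uu.2 i)%:R * a' i != 0) _ Fa) => -[u u'] /=.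
have [->|uu'] := eqVneq u u'; first by near=> a'.
have auu : \sum_i (u i)%:R * a i - \sum_i (u' i)%:R * a i != 0.
  by rewrite subr_eq0; apply: contra uu' => /eqP/ainj ->.
have uc := @linear_form_continuous R d _ (fun i => (u i)%:R) id a.
have u'c := @linear_form_continuous R d _ (fun i => (u' i)%:R) id a.
have auu' := @cvgr_neq0 _ _ _ _ Fa _ _ (cvgB uc u'c) auu.
by apply: (@filterS _ _ Fa) (auu' Fa) => a' + _.
Unshelve. all: by end_near.
Qed.

Lemma small_nonroot (p : {poly R}) (e : R) : p != 0 -> 0 < e ->
  exists s : R, [/\ 0 < s, s < e & ~~ root p s].
Proof.
move=> p0 e0; pose s n : R := e / n.+2%:R.
have s_inj : injective s.
  move=> m n /(mulfI (lt0r_neq0 e0))/invr_inj/eqP.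
  by rewrite eqr_nat => /eqP[].
have : ~~ all (root p) (mkseq s (size p)).
  apply/negP => rs.
  have := max_poly_roots p0 rs; rewrite size_mkseq ltnn => H.
  by apply: (notF (H _)); rewrite mkseq_uniq.
case/allPn => x /mapP[n _ ->] nr; exists (s n); split=> //.
  by rewrite divr_gt0.
by rewrite ltr_pdivrMr // ltr_pMr // ltr1n.
Qed.

(** Along the curve [s |-> a + (s, s ^ 2, s ^ 3, ...)] the coincidence of two
    given monomials is a nontrivial polynomial equation in [s]. *)
Lemma generic_coeffs_dense D a (V : set {ptws lattice_pt d -> R}) :
  nbhs (a : {ptws lattice_pt d -> R}) V -> exists2 a', V a' & generic_coeffs D a'.
Proof.
move=> aV.
pose g (s : R) : {ptws lattice_pt d -> R} := fun i => a i + s ^+ (enum_rank i).+1.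
have gc : g @ (0 : R) --> (a : {ptws lattice_pt d -> R}).
  have Fg : Filter (g @ (0 : R)) by exact: fmap_filter.
  apply/cvg_sup => i U [_ /= [[W oW <-]]] /= Wa /(@filterS _ _ Fg); apply.
  have gic : (fun s => g s i) @ (0 : R) --> a i.
    have -> : a i = a i + 0 ^+ (enum_rank i).+1 by rewrite expr0n addr0.
    apply: cvgD; first exact: cvg_cst.
    exact: exprn_continuous.
  by apply: gic; exact: open_nbhs_nbhs.
have /nbhs_ballP[e /= e0 eV] := gc _ aV.
pose q (u u' : {ffun lattice_pt d -> 'I_D}) : {poly R} :=
  \sum_i ((u i)%:R - (u' i)%:R) *: ((a i)%:P + 'X ^+ (enum_rank i).+1).
have qE u u' s : (q u u').[s] = \sum_i (u i)%:R * g s i - \sum_i (u' i)%:R * g s i.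
  rewrite -sumrB horner_sum; apply: eq_bigr => i _.
  by rewrite !hornerE mulrBl.
have q0 u u' : u != u' -> q u u' != 0.
  apply: contraNneq => quu'; apply/eqP/ffunP => i; apply/val_inj => /=.
  have /polyP/(_ (enum_rank i).+1) := quu'.
  rewrite coef_sum (bigD1 i) //= big1 => [|j ji]; last first.
    rewrite !coefE /= eqSS (inj_eq val_inj) (inj_eq enum_rank_inj) eq_sym.
    by rewrite (negPf ji) add0r mulr0.
  rewrite !coefE /= eqxx add0r mulr1 addr0 => /eqP.
  by rewrite subr_eq0 eqr_nat => /eqP.
have [|s [s0 se /negP sroot]] := @small_nonroot
    (\prod_(uu : _ * _ | uu.1 != uu.2) q uu.1 uu.2) e _ e0.
  by apply/prodf_neq0 => -[u u'] /q0.
exists (g s).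
  by apply: eV; rewrite /ball /= sub0r normrN gtr0_norm.
move=> u u' /eqP; rewrite -subr_eq0 -qE => uu'.
apply/eqP; apply: contra_notT sroot => uu''.
by rewrite (bigD1 (u, u')) //= rootM /root uu'.
Qed.

(** The open dense subset is the complement in the cone of finitely many
    hyperplanes. *)
Lemma generically_generic_coeffs D T :
    @regular_primitive_triangulation R d T ->
  forall P : (lattice_pt d -> R) -> Prop,
    (forall a, dual_subdivision a = T -> generic_coeffs D a -> P a) ->
  generically T P.
Proof.
move=> [_ Tprim] P TP; exists (cone_of T `&` generic_coeffs D); split.
- by move=> a [].
- rewrite openE => a [aT aD]; apply: filterI; first exact: cone_of_open.
  exact: generic_coeffs_open.
- move=> a aT V aV.
  have aVT : nbhs (a : {ptws lattice_pt d -> R}) (V `&` cone_of T).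
    by apply: filterI => //; exact: cone_of_open.
  have [a' [a'V a'T] a'D] := generic_coeffs_dense D aVT.
  by exists a'.
- by move=> a [aT aD]; exact: TP.
Qed.

End Generic.

(** * Orders of growth *)

Local Notation normc := ComplexField.Normc.normc.

Section Normc.
Context {R : realType}.
Implicit Types (z : R[i]).

Lemma normc_ge0 z : 0 <= normc z.
Proof. by case: z => x y; exact: sqrtr_ge0. Qed.

Lemma normc_gt0 z : (0 < normc z) = (z != 0).
Proof.
rewrite lt_def normc_ge0 andbT; congr negb; apply/eqP/eqP => [|->].
  exact: ComplexField.Normc.eq0_normc.
exact: ComplexField.Normc.normc0.
Qed.

Lemma normcX z n : normc (z ^+ n) = normc z ^+ n.
Proof.
elim: n => [|n IHn]; first by rewrite !expr0 ComplexField.Normc.normc1.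
by rewrite !exprS ComplexField.Normc.normcM IHn.
Qed.

Lemma normc_prod (I : Type) (r : seq I) (f : I -> R[i]) :
  normc (\prod_(i <- r) f i) = \prod_(i <- r) normc (f i).
Proof.
elim: r => [|i r IHr]; first by rewrite !big_nil ComplexField.Normc.normc1.
by rewrite !big_cons ComplexField.Normc.normcM IHr.
Qed.

Lemma normc_sum (I : Type) (r : seq I) (P : pred I) (f : I -> R[i]) :
  normc (\sum_(i <- r | P i) f i) <= \sum_(i <- r | P i) normc (f i).
Proof.
elim/big_rec2: _ => [|i x z _ xz]; first by rewrite ComplexField.Normc.normc0.
by apply: (le_trans (le_normcD _ _)); rewrite lerD2l.
Qed.

Lemma normc_real (r : R) : 0 <= r -> normc (r%:C)%C = r.
Proof. by move=> r0; rewrite /= expr0n addr0 sqrtr_sqr ger0_norm. Qed.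

Lemma normc_le_sum_others (I : finType) (P : pred I) (f : I -> R[i]) i :
  P i -> \sum_(j | P j) f j = 0 ->
  normc (f i) <= \sum_(j | P j && (j != i)) normc (f j).
Proof.
move=> Pi; rewrite (bigD1 i) //= => /eqP; rewrite addr_eq0 => /eqP ->.
by rewrite normcN; exact: normc_sum.
Qed.

End Normc.

Section Growth.
Context {R : realType}.
Implicit Types (t b e : R) (y : R -> R[i]).

Lemma powR_near_ge e (K : R) : 0 < e -> \forall t \near +oo, K <= t `^ e.
Proof.
move=> e0; pose K' := Num.max K 1.
have K'0 : 0 < K' by rewrite lt_max ltr01 orbT.
near=> t.
have Kt : K' `^ e^-1 <= t by near: t; exact: nbhs_pinfty_ge.
have K0 : K' `^ e^-1 \in Num.nneg by rewrite nnegrE powR_ge0.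
have t0 : t \in Num.nneg by rewrite nnegrE; near: t; exact: nbhs_pinfty_ge.
have := ge0_ler_powR (ltW e0) K0 t0 Kt.
rewrite -powRrM mulVf ?gt_eqF // powRr1 ?(ltW K'0) //; apply: le_trans.
by rewrite le_max lexx.
Unshelve. all: by end_near.
Qed.

Lemma powR_add t b e : 0 < t -> t `^ (b + e) = t `^ b * t `^ e.
Proof. by move=> t0; rewrite powRD // (gt_eqF t0) implybT. Qed.

(** This is the convergence of [log_t |y t|] to [b], in a form that excludes
    [y t = 0], where the logarithm has a default value. *)
Definition growth y b : Prop := forall e, 0 < e ->
  \forall t \near +oo, t `^ (b - e) <= normc (y t) <= t `^ (b + e).

Lemma growth_neq0 y b : growth y b -> \forall t \near +oo, y t != 0.
Proof.
move=> /(_ 1 ltr01); apply: filterS2 (nbhs_pinfty_gt (num_real (0 : R))) => t t0.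
by move=> /andP[yt _]; rewrite -normc_gt0; apply: lt_le_trans yt; exact: powR_gt0.
Qed.

Lemma eq_growth y y' b :
  (\forall t \near +oo, y t = y' t) -> growth y b -> growth y' b.
Proof. by move=> yy' yb e /yb; apply: filterS2 yy' => t ->. Qed.

Lemma growthM y y' b b' :
  growth y b -> growth y' b' -> growth (fun t => y t * y' t) (b + b').
Proof.
move=> yb yb' e e0; have e20 : 0 < e / 2 by rewrite divr_gt0.
near=> t; have t0 : 0 < t by near: t; exact: nbhs_pinfty_gt.
have /andP[y1 y2] : t `^ (b - e / 2) <= normc (y t) <= t `^ (b + e / 2).
  by near: t; exact: yb.
have /andP[y'1 y'2] : t `^ (b' - e / 2) <= normc (y' t) <= t `^ (b' + e / 2).
  by near: t; exact: yb'.
rewrite ComplexField.Normc.normcM.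
rewrite (_ : b + b' - e = (b - e / 2) + (b' - e / 2)); last by field.
rewrite (_ : b + b' + e = (b + e / 2) + (b' + e / 2)); last by field.
rewrite (powR_add (b - e / 2)) // (powR_add (b + e / 2)) //.
by rewrite !ler_pM ?powR_ge0 ?normc_ge0.
Unshelve. all: by end_near.
Qed.

Lemma growth_cst (c : R[i]) : c != 0 -> growth (fun=> c) 0.
Proof.
move=> c0 e e0; near=> t.
have t0 : 0 < t by near: t; exact: nbhs_pinfty_gt.
rewrite add0r add0r powRN; apply/andP; split; last first.
  by near: t; exact: powR_near_ge.
rewrite -[leRHS]invrK lef_pV2 ?posrE ?powR_gt0 ?invr_gt0 ?normc_gt0 //.
by near: t; exact: powR_near_ge.
Unshelve. all: by end_near.
Qed.

Lemma growthX y b n : growth y b -> growth (fun t => y t ^+ n) (n%:R * b).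
Proof.
move=> yb; elim: n => [|n IHn].
  rewrite mul0r; apply: eq_growth (growth_cst (oner_neq0 _)).
  by near=> t; rewrite expr0.
rewrite -natr1 addrC mulrDl mul1r; apply: eq_growth (growthM yb IHn).
by near=> t; rewrite exprS.
Unshelve. all: by end_near.
Qed.

Lemma growth_prod (J : finType) (y : J -> R -> R[i]) (b : J -> R) (n : J -> nat) :
    (forall j, growth (y j) (b j)) ->
  growth (fun t => \prod_j y j t ^+ n j) (\sum_j (n j)%:R * b j).
Proof.
move=> yb; elim: (index_enum J) => [|j r IHr].
  rewrite big_nil; apply: eq_growth (growth_cst (oner_neq0 _)).
  by near=> t; rewrite big_nil.
rewrite big_cons; apply: eq_growth (growthM (growthX (n j) (yb j)) IHr).
by near=> t; rewrite big_cons.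
Unshelve. all: by end_near.
Qed.

(** The largest term of a sum dominates the others; hence, in a sum that
    vanishes, the maximal order is attained twice. *)
Lemma dominant_term (M : finType) (P : pred M) (y : M -> R -> R[i]) (b : M -> R) m :
    (forall k, P k -> growth (y k) (b k)) -> P m ->
    (forall k, P k -> k != m -> b k < b m) ->
  \forall t \near +oo, \sum_(k | P k) y k t != 0.
Proof.
move=> yb Pm bm.
have [|e e0 be] := @small_scale R M (fun k => P k && (k != m)) (fun k => b m - b k)
  (fun=> 3).
  by move=> k /andP[Pk km]; rewrite subr_gt0 bm.
near=> t; have t0 : 0 < t by near: t; exact: nbhs_pinfty_gt.
have t1 : 1 <= t by near: t; exact: nbhs_pinfty_ge.
have yt k : P k -> t `^ (b k - e) <= normc (y k t) <= t `^ (b k + e).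
  have [Pk|//] := boolP (P k); move=> _; move: k Pk; near: t.
  suff H : \forall t \near +oo, forall k, P k ->
      t `^ (b k - e) <= normc (y k t) <= t `^ (b k + e).
    by apply: filterS H => t H k /H.
  apply: filter_forall => k; have [Pk|_] := boolP (P k); last by near=> t.
  by apply: filterS (yb k Pk e e0).
have te : #|M|%:R + 1 <= t `^ e by near: t; exact: powR_near_ge.
apply/eqP => /(normc_le_sum_others Pm); apply/negP; rewrite -ltNge.
have /andP[ym _] := yt m Pm.
apply: (@le_lt_trans _ _ (\sum_(k | P k && (k != m)) t `^ (b m - e) * t `^ (- e))).
  apply: ler_sum => k /andP[Pk km]; have /andP[_ yk] := yt k Pk.
  apply: le_trans yk _; rewrite -powR_add //; apply: ler_powR => //.
  by have := be k; rewrite Pk km => /(_ isT); lra.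
rewrite sumr_const -mulr_natr -mulrA; apply: lt_le_trans ym.
rewrite gtr_pMr ?powR_gt0 // powRN mulrC ltr_pdivrMr ?powR_gt0 // mul1r.
apply: lt_le_trans te; rewrite ltr_pwDr // ler_nat; exact: max_card.
Unshelve. all: by end_near.
Qed.

(** By [dominant_term], applied to the monomials of the relation, two of them have
    the maximal order. *)
Lemma tropical_relation (J : finType) (D : nat) (c : {ffun J -> 'I_D} -> R[i])
    (y : J -> R -> R[i]) (b : J -> R) :
    (exists m, c m != 0) -> (forall j, growth (y j) (b j)) ->
    (\forall t \near +oo, \sum_m c m * \prod_j y j t ^+ m j = 0) ->
  exists m m' : {ffun J -> 'I_D},
    m != m' /\ \sum_j (m j)%:R * b j = \sum_j (m' j)%:R * b j.
Proof.
move=> [m0 cm0] yb y0; pose w (m : {ffun J -> 'I_D}) := \sum_j (m j)%:R * b j.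
pose m := [arg max_(m > m0 | c m != 0) w m]%O.
have [cm mmax] : c m != 0 /\ forall k, c k != 0 -> w k <= w m.
  by rewrite /m; case: arg_maxP => // k ck kmax; split=> // l /kmax.
have [[k /and3P[ck km wk]]|nk] := pselect (exists k, [&& c k != 0, k != m & w m <= w k]).
  by exists k, m; split=> //; apply: le_anti; rewrite mmax.
exfalso.
have yw k : c k != 0 -> growth (fun t => c k * \prod_j y j t ^+ k j) (w k).
  by move=> ck; rewrite -[w k]add0r; apply: growthM (growth_cst ck) (growth_prod _ yb).
have mlt k : c k != 0 -> k != m -> w k < w m.
  move=> ck km; rewrite ltNge; apply/negP => wk; apply: nk; exists k.
  by rewrite ck km.
suff : \forall t \near (+oo : set_system R), False by move=> /filter_ex[].
apply: filterS2 y0 (dominant_term yw cm mlt) => t y0 /eqP; apply.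
move: y0; rewrite (bigID (fun k => c k != 0)) /= [X in _ + X]big1 ?addr0 //.
by move=> k /negPn/eqP ->; rewrite mul0r.
Qed.

End Growth.

(** * The coefficients of an approximating family *)

Section Coefficients.
Context {R : realType}.
Local Notation C := R[i].
Local Notation coord := Defs.coord.

Lemma hausdorff_limit_near (A : R -> set 'rV[R]_3) X x e :
    hausdorff_limit A X -> X x -> 0 < e ->
  \forall t \near +oo, exists2 y, A t y & `|x - y| < e.
Proof.
move=> AX Xx e0; have := AX [set x] e (@compact_set1 _ x) e0.
by apply: filterS => t [+ _] => /(_ x); apply; split.
Qed.

Lemma normr_coord n (u : 'rV[R]_n) j : `|u 0 j| <= `|u|.
Proof.
by rewrite [leRHS]mx_normrE (le_bigmax _ (fun ij => `|u ij.1 ij.2|) (ord0, j)).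
Qed.

Lemma normc_powR_Log n t (z : 'rV[C]_n) j : 1 < t -> z 0 j != 0 ->
  normc (z 0 j) = t `^ (Log t z 0 j).
Proof.
move=> t1 zj; rewrite mxE /powR gt_eqF ?(lt_trans ltr01) //.
by rewrite divfK ?lnK ?posrE ?normc_gt0 // gt_eqF // ln_gt0.
Qed.

Lemma normc_monomial d t (z : 'rV[C]_3) (i : lattice_pt d) : 1 < t -> torus z ->
  normc (\prod_j z 0 j ^+ coord i j) = t `^ dotv (pt_vec R i) (Log t z).
Proof.
move=> t1 zT; have t0 : 0 < t by exact: lt_trans t1.
have -> : dotv (pt_vec R i) (Log t z) = \sum_j (coord i j)%:R * Log t z 0 j.
  by apply: eq_bigr => j _; rewrite mxE.
rewrite normc_prod; elim: (index_enum 'I_3) => [|j r IHr].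
  by rewrite !big_nil powRr0.
rewrite !big_cons IHr powR_add //; congr (_ * _).
by rewrite normcX mulrC powRrM powR_mulrn ?powR_ge0 // -normc_powR_Log.
Qed.

Lemma dotv_pt_le d (i : lattice_pt d) (u : 'rV[R]_3) :
  `|dotv (pt_vec R i) u| <= (3 * d)%:R * `|u|.
Proof.
apply: le_trans (ler_norm_sum _ _ _) _.
apply: (@le_trans _ _ (\sum_(j < 3) d%:R * `|u|)); last first.
  by rewrite sumr_const card_ord -mulrnAl -mulrnA mulnC.
apply: ler_sum => j _; rewrite normrM ler_pM ?normr_coord //.
by rewrite mxE ger0_norm ?ler0n // ler_nat -ltnS ltn_ord.
Qed.

Lemma newton_polytope_neq0 d (P : lattice_pt d -> C) :
  newton_polytope P = Delta R d -> exists i, P i != 0.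
Proof.
move=> PD; apply: contrapT => /forallNP P0.
have : Delta R d 0 by move=> B [_ GB]; apply: GB; left.
rewrite -PD => /(_ set0); apply; split=> [x y l /[!inE] //|].
by move=> y [i /P0].
Qed.

Variables (d : nat) (a : lattice_pt d -> R) (P : R -> lattice_pt d -> C).
Hypothesis P_neq0 : forall t, 1 < t -> exists i, P t i != 0.
Hypothesis P_approx : forall x e, affine_tropical_surface a x -> 0 < e ->
  \forall t \near +oo, exists z, [/\ torus z,
    \sum_i P t i * \prod_j z 0 j ^+ coord i j = 0 & `|x - Log t z| < e].

(** The size of a coefficient in units of the expected [t ^ a i]. *)
Definition rel_coeff t i : R := normc (P t i) * t `^ (- a i).

Definition max_coeff t : R := \big[Num.max/0]_i rel_coeff t i.

Lemma rel_coeff_le t i : rel_coeff t i <= max_coeff t.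
Proof. exact: le_bigmax. Qed.

Lemma rel_coeff_ge0 t i : 0 <= rel_coeff t i.
Proof. by rewrite mulr_ge0 ?normc_ge0 ?powR_ge0. Qed.

Lemma max_coeff_gt0 t : 1 < t -> 0 < max_coeff t.
Proof.
move=> t1; have [i Pi] := P_neq0 t1; apply: lt_le_trans (rel_coeff_le t i).
by rewrite mulr_gt0 ?normc_gt0 // powR_gt0 // (lt_trans ltr01).
Qed.

(** This is an implication, and not a bound for [j] alone, because the index of the
    coefficient of size [max_coeff t] depends on [t]. *)
Definition comparable_coeffs i j : Prop := forall e, 0 < e ->
  exists2 e', 0 < e' & \forall t \near +oo,
    max_coeff t * t `^ (- e') <= rel_coeff t i ->
    max_coeff t * t `^ (- e) <= rel_coeff t j.

(** Over a point of the facet dual to the edge from [i] to [j] there are zeros of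
    the polynomial, where the term [i] has to be cancelled; all terms other than
    [j] are too small for that. *)
Lemma edge_comparable i j x :
  argmax_set a x = [set i; j]%SET -> comparable_coeffs i j.
Proof.
move=> xij e e0; have [<-|ij] := eqVneq i j.
  by exists e => //; near=> t.
have [s1 s10 s1E] := @small_scale R _ (fun k => k \notin argmax_set a x)
  (fun k => trop_poly a x - trop_term a x k) (fun=> 2)
  (fun k kx => etrans (subr_gt0 _ _) (trop_term_lt kx)).
(* At [x] the terms other than [i] and [j] are smaller by [t ^ (2 s)]; moving
   to a zero close to [x] changes the exponents by at most [s / 4]. *)
pose s := Num.min s1 (e / 2).
have s0 : 0 < s by rewrite lt_min s10 divr_gt0.
have se : 2 * s <= e by rewrite mulrC -ler_pdivlMr // ge_min lexx orbT.
have sE k : k \notin argmax_set a x -> trop_term a x k <= trop_poly a x - 2 * s.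
  move=> /s1E; have : s <= s1 by rewrite ge_min lexx.
  lra.
exists (s / 2); first by rewrite divr_gt0.
have xS : affine_tropical_surface a x by rewrite /affine_tropical_surface /= xij cards2 ij.
pose r := s / 4 / (3 * d).+1%:R.
have r0 : 0 < r by rewrite !divr_gt0.
near=> t => iW.
have t1 : 1 < t by near: t; exact: nbhs_pinfty_gt.
have t0 : 0 < t by exact: lt_trans t1.
have [z [zT z0 xz]] : exists z, [/\ torus z,
    \sum_i P t i * \prod_j z 0 j ^+ coord i j = 0 & `|x - Log t z| < r].
  by near: t; exact: P_approx.
have ts : #|{: lattice_pt d}|%:R + 1 <= t `^ s by near: t; exact: powR_near_ge.
have W0 := max_coeff_gt0 t1.
pose h k := trop_term a (Log t z) k.
have hE k : `|h k - trop_term a x k| <= s / 4.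
  rewrite /h -[Log t z](subrK x) [_ + x]addrC trop_termDr addrAC subrr add0r.
  apply: le_trans (dotv_pt_le _ _) _; rewrite distrC.
  apply: (@le_trans _ _ ((3 * d).+1%:R * r)); last by rewrite mulrC divfK.
  by apply: ler_pM; rewrite ?ler0n ?ler_nat //; exact: ltW.
have termE k : normc (P t k * \prod_j z 0 j ^+ coord k j) = rel_coeff t k * t `^ h k.
  rewrite ComplexField.Normc.normcM (normc_monomial _ t1) // /rel_coeff -mulrA -powR_add //.
  by rewrite /h trop_termE addrA addNr add0r.
have := normc_le_sum_others (i := i) isT z0.
rewrite termE (bigD1 j) /=; last by rewrite eq_sym.
rewrite termE => iSum.
have ipoly : trop_term a x i = trop_poly a x.
  by apply/eqP; rewrite -mem_argmax xij !inE eqxx.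
have jpoly : trop_term a x j = trop_poly a x.
  by apply/eqP; rewrite -mem_argmax xij !inE eqxx orbT.
set M := trop_poly a x in ipoly jpoly sE.
have rest : \sum_(k | (k != i) && (k != j)) normc (P t k * \prod_j0 z 0 j0 ^+ coord k j0)
    <= #|{: lattice_pt d}|%:R * (max_coeff t * t `^ (M - 2 * s + s / 4)).
  apply: (@le_trans _ _ (\sum_(k | (k != i) && (k != j)) max_coeff t * t `^ (M - 2 * s + s / 4))).
    apply: ler_sum => k /andP[ki kj]; rewrite termE.
    rewrite ler_pM ?rel_coeff_ge0 ?powR_ge0 ?rel_coeff_le //.
    apply: ler_powR; first exact: ltW.
    have := sE k; rewrite xij !inE (negPf ki) (negPf kj) => /(_ isT).
    by have := hE k; rewrite ler_norml => /andP[_]; lra.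
  rewrite sumr_const -[leLHS]mulr_natl ler_wpM2r ?ler_nat ?max_card //.
  by rewrite mulr_ge0 ?powR_ge0 // ltW.
have il : max_coeff t * t `^ (- (s / 2)) * t `^ (M - s / 4) <= rel_coeff t i * t `^ h i.
  rewrite ler_pM ?mulr_ge0 ?powR_ge0 ?(ltW W0) //; apply: ler_powR; first exact: ltW.
  by have := hE i; rewrite ler_norml ipoly => /andP[+ _]; lra.
have jl : rel_coeff t j * t `^ h j <= rel_coeff t j * t `^ (M + s / 4).
  rewrite ler_wpM2l ?rel_coeff_ge0 //; apply: ler_powR; first exact: ltW.
  by have := hE j; rewrite ler_norml jpoly => /andP[_]; lra.
have : max_coeff t * t `^ (- (s / 2)) * t `^ (M - s / 4) <=
    rel_coeff t j * t `^ (M + s / 4) +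
    #|{: lattice_pt d}|%:R * (max_coeff t * t `^ (M - 2 * s + s / 4)).
  by apply: le_trans il _; apply: le_trans iSum _; exact: lerD.
rewrite -mulrA -powR_add //.
have -> : - (s / 2) + (M - s / 4) = (M + s / 4) + - s by field.
have -> : M - 2 * s + s / 4 = (M + s / 4) + (- s + - s) by ring.
rewrite !(powR_add (M + s / 4)) // (powR_add (- s)) //.
have ms : t `^ (- s) * t `^ s = 1 by rewrite -powR_add // addNr powRr0.
have es : t `^ (- e) <= t `^ (- s) * t `^ (- s).
  by rewrite -powR_add //; apply: ler_powR; [exact: ltW|lra].
have q0 : 0 < t `^ (- s) by exact: powR_gt0.
have Ms : 0 < t `^ (M + s / 4) by exact: powR_gt0.
move: (t `^ (M + s / 4)) (t `^ (- s)) (t `^ s) (t `^ (- e)) Ms q0 ms es ts (max_coeff t) W0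
  (rel_coeff t j) => A q Q E A0 q0 qQ Eq NQ W W0 w.
have -> : W * (A * q) = A * (W * q) by ring.
have -> : w * A + #|{: lattice_pt d}|%:R * (W * (A * (q * q))) =
    A * (w + #|{: lattice_pt d}|%:R * (W * (q * q))) by ring.
rewrite ler_pM2l //.
move: (#|_|%:R) NQ => N NQ ineq.
have : W * E <= W * (q * q) by rewrite ler_pM2l.
have : (N + 1) * (W * (q * q)) <= W * q.
  have -> : W * q = Q * (W * (q * q)) by rewrite -[q in LHS]mulr1 -qQ; ring.
  by rewrite ler_wpM2r // !mulr_ge0 ?ltW.
lra.
Unshelve. all: by end_near.
Qed.

Lemma comparable_coeffs_trans i j k :
  comparable_coeffs i j -> comparable_coeffs j k -> comparable_coeffs i k.
Proof.
move=> ij jk e /jk[e' /ij[e'' e''0 ije] jke]; exists e'' => //.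
by apply: filterS2 ije jke => t ij' jk' /ij'/jk'.
Qed.

Hypothesis Tprim : primitive_triangulation (dual_subdivision a).

Lemma all_comparable i j : comparable_coeffs i j.
Proof.
pose I := [set k | `[< comparable_coeffs i k >]]%SET.
suff : j \in I by rewrite !inE.
apply: (edge_connected Tprim (i0 := i)) => [|k l x xkl]; rewrite !inE.
  by move=> e e0; exists e => //; near=> t.
move=> ik; exact: comparable_coeffs_trans ik (edge_comparable xkl).
Unshelve. all: by end_near.
Qed.

(** At each [t] one of the coefficients has size [max_coeff t]; all the others
    are comparable to it. *)
Lemma coeff_growth i : growth (fun t => P t i / ((max_coeff t)%:C)%C) (a i).
Proof.
move=> e e0.
have : \forall t \near +oo, forall k,
    max_coeff t <= rel_coeff t k -> max_coeff t * t `^ (- e) <= rel_coeff t i.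
  apply: filter_forall => k; have [e' e'0] := all_comparable k i e0.
  apply: filterS2 (nbhs_pinfty_gt (num_real (1 : R))) => t t1 kt tk; apply: kt.
  apply: le_trans tk; rewrite ler_piMr ?(ltW (max_coeff_gt0 _)) //.
  by rewrite -[leRHS](powRr0 t); apply: ler_powR; rewrite ?oppr_le0 ltW.
apply: filterS2 (nbhs_pinfty_gt (num_real (1 : R))) => t t1 maxE.
have t0 : 0 < t by exact: lt_trans t1.
have W0 := max_coeff_gt0 t1.
have [k _ kmax] : exists2 k, true & max_coeff t = rel_coeff t k.
  have [k Pk] := P_neq0 t1.
  have [//||k' _ kE] := @eq_bigmax _ _ _ 0 k predT (rel_coeff t).
    by move=> l _; exact: rel_coeff_ge0.
  by exists k'.
have iW : max_coeff t * t `^ (- e) <= rel_coeff t i by apply: (maxE k); rewrite kmax.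
have -> : normc (P t i / ((max_coeff t)%:C)%C) = rel_coeff t i / max_coeff t * t `^ a i.
  rewrite ComplexField.Normc.normcM ComplexField.Normc.normcV normc_real ?ltW //.
  rewrite mulrAC /rel_coeff -[normc _ * _ * _]mulrA -powR_add //.
  by rewrite addNr powRr0 mulr1.
rewrite !(powR_add (a i)) // ![t `^ a i * _]mulrC !ler_pM2r ?powR_gt0 //.
rewrite ler_pdivlMr // [_ * max_coeff t]mulrC iW /=.
apply: (@le_trans _ _ 1); first by rewrite ler_pdivrMr // mul1r rel_coeff_le.
by rewrite -[leLHS](powRr0 t); apply: ler_powR; exact: ltW.
Qed.

End Coefficients.

(** * The coefficients of an approximating family of lines *)

Section LineCoefficients.
Context {R : realType}.
Local Notation C := R[i].
Variables (p v : R -> 'rV[C]_3) (i j : 'I_3).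

(** The Pluecker coordinate of the line through [p] with direction [v] that is the
    constant term of the equation between its coordinates [i] and [j]. *)
Definition plucker t : C := v t 0 j * p t 0 i - v t 0 i * p t 0 j.

(** The form in which the convergence to a tropical line is used: at one of its
    points, and only for the coordinates [i] and [j]. *)
Definition line_limit_point (b b' : R) : Prop := forall e, 0 < e ->
  \forall t \near +oo, exists z, [/\ torus z, exists s, z = p t + s *: v t,
    `|b - Log t z 0 i| < e & `|b' - Log t z 0 j| < e].

Lemma plucker_trinomial t (s : C) :
  plucker t = v t 0 j * (p t + s *: v t) 0 i - v t 0 i * (p t + s *: v t) 0 j.
Proof. by rewrite /plucker !mxE; ring. Qed.

Lemma trinomial_bounds t e b b' : 1 < t ->
    (exists z, [/\ torus z, exists s, z = p t + s *: v t,
      `|b - Log t z 0 i| < e & `|b' - Log t z 0 j| < e]) ->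
  [/\ normc (plucker t) <=
        normc (v t 0 j) * t `^ (b + e) + normc (v t 0 i) * t `^ (b' + e),
      normc (v t 0 j) * t `^ (b - e) <=
        normc (plucker t) + normc (v t 0 i) * t `^ (b' + e) &
      normc (v t 0 i) * t `^ (b' - e) <=
        normc (plucker t) + normc (v t 0 j) * t `^ (b + e)].
Proof.
move=> t1 [z [zT [s zE] zb zb']]; rewrite (plucker_trinomial t s) -zE.
have bounds k c : `|c - Log t z 0 k| < e ->
    t `^ (c - e) <= normc (z 0 k) <= t `^ (c + e).
  rewrite ltr_norml => /andP[c1 c2].
  rewrite (normc_powR_Log t1 (zT k)); apply/andP; split; apply: ler_powR; lra.
have /andP[bi1 bi2] := bounds _ _ zb; have /andP[bj1 bj2] := bounds _ _ zb'.
have vi0 := normc_ge0 (v t 0 i); have vj0 := normc_ge0 (v t 0 j).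
set x := v t 0 j * z 0 i; set y := v t 0 i * z 0 j.
have xE : normc x = normc (v t 0 j) * normc (z 0 i) by exact: ComplexField.Normc.normcM.
have yE : normc y = normc (v t 0 i) * normc (z 0 j) by exact: ComplexField.Normc.normcM.
have xle : normc x <= normc (v t 0 j) * t `^ (b + e) by rewrite xE ler_wpM2l.
have yle : normc y <= normc (v t 0 i) * t `^ (b' + e) by rewrite yE ler_wpM2l.
have xge : normc (v t 0 j) * t `^ (b - e) <= normc x by rewrite xE ler_wpM2l.
have yge : normc (v t 0 i) * t `^ (b' - e) <= normc y by rewrite yE ler_wpM2l.
have t1' : normc (x - y) <= normc x + normc y.
  by apply: le_trans (le_normcD _ _) _; rewrite normcN.
have t2 : normc x <= normc (x - y) + normc y.
  by rewrite -{1}[x](subrK y); exact: le_normcD.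
have t3 : normc y <= normc (x - y) + normc x.
  rewrite -{1}[y](subrK x) -(normcN (x - y)) opprB; exact: le_normcD.
split; lra.
Qed.

(** The terms [X], [Y], [K] of an equation at the vertex of a plane tropical line
    are of the same size: on each of the three ends, at the distance [S], two of
    them cancel each other, up to the errors [E]. *)
Lemma tripod_bounds (X Y K E S : R) : 0 <= X -> 0 <= Y -> 0 <= K ->
    1 <= E -> 8 * E ^+ 4 <= S ->
    X * (S / E) <= K + Y * (S * E) -> Y * (S / E) <= K + X * (S * E) ->
    X / E <= K + Y * (E / S) -> K <= X * E + Y * (E / S) ->
    Y / E <= K + X * (E / S) -> K <= X * (E / S) + Y * E ->
  [/\ X <= 4 * E ^+ 2 * Y, Y <= 4 * E ^+ 2 * X, K <= 5 * E ^+ 3 * X & X <= 2 * E * K].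
Proof.
move=> X0 Y0 K0 E1 ES D1 D2 B1 B2 A1 A2.
have E0 : 0 < E by lra.
have E4 : 1 <= E ^+ 4 by exact: exprn_ege1.
have S0 : 0 < S by lra.
pose f := E^-1; pose q := E / S.
have Ef : E * f = 1 by rewrite mulfV ?gt_eqF.
have f0 : 0 < f by rewrite invr_gt0.
have f1 : f <= 1 by rewrite invf_le1.
have q0 : 0 < q by rewrite divr_gt0.
have qf : q <= f ^+ 3 / 8.
  rewrite ler_pdivrMr //; apply: (@le_trans _ _ (f ^+ 3 / 8 * (8 * E ^+ 4))).
    by rewrite le_eqVlt; apply/orP; left; apply/eqP; rewrite /f; field; rewrite gt_eqF.
  by rewrite ler_wpM2l // divr_ge0 // exprn_ge0 // ltW.
have q8 : q <= 8^-1.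
  by apply: le_trans qf _; rewrite ler_piMl // exprn_ile1 // ltW.
have Sq : S * E * q = E ^+ 2 by rewrite /q; field; rewrite gt_eqF.
have Sq' : S / E * q = 1 by rewrite /q; field; rewrite !gt_eqF.
have scaled Z : 0 <= Z -> Z * q <= Z / 8 by move=> Z0; rewrite ler_wpM2l.
have pow_le Z : 0 <= Z -> Z <= Z * E /\ Z * E <= Z * E ^+ 2.
  by move=> Z0; rewrite expr2 mulrA !ler_peMr // mulr_ge0 // ltW.
have D1q : X <= K * q + Y * E ^+ 2.
  by have := ler_wpM2r (ltW q0) D1; rewrite -(mulrA X) Sq' mulr1 mulrDl -(mulrA Y) Sq.
have D2q : Y <= K * q + X * E ^+ 2.
  by have := ler_wpM2r (ltW q0) D2; rewrite -(mulrA Y) Sq' mulr1 mulrDl -(mulrA X) Sq.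
rewrite -/q in B1 B2 A1 A2.
have Xq := scaled X X0; have Yq := scaled Y Y0; have Kq := scaled K K0.
have [XE XE2] := pow_le X X0; have [YE YE2] := pow_le Y Y0.
have XY : X <= 2 * (Y * E ^+ 2) by lra.
have YX : Y <= 2 * (X * E ^+ 2) by lra.
have YEX : Y * E <= 2 * (X * E ^+ 3).
  have -> : 2 * (X * E ^+ 3) = 2 * (X * E ^+ 2) * E by ring.
  by rewrite ler_wpM2r // ltW.
have XE3 : X * E ^+ 2 <= X * E ^+ 3.
  by rewrite [E ^+ 3]exprSr mulrA ler_peMr // mulr_ge0 // exprn_ge0 // ltW.
have YqX : Y * q <= X * f / 4.
  apply: (@le_trans _ _ (2 * (X * E ^+ 2) * (f ^+ 3 / 8))).
    by apply: ler_pM => //; exact: ltW.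
  rewrite le_eqVlt; apply/orP; left; apply/eqP.
  by rewrite /f; field; rewrite gt_eqF.
have XfK : X * f <= 4 / 3 * K by rewrite -/f in B1; lra.
have XK : X <= 4 / 3 * (K * E).
  have := ler_wpM2r (ltW E0) XfK; rewrite -(mulrA X) [f * E]mulrC Ef mulr1; lra.
have KE0 : 0 <= K * E by rewrite mulr_ge0 // ltW.
split.
- have -> : 4 * E ^+ 2 * Y = 4 * (Y * E ^+ 2) by ring.
  lra.
- have -> : 4 * E ^+ 2 * X = 4 * (X * E ^+ 2) by ring.
  lra.
- have -> : 5 * E ^+ 3 * X = 5 * (X * E ^+ 3) by ring.
  lra.
- have -> : 2 * E * K = 2 * (K * E) by ring.
  lra.
Qed.

(** Here [(m, m')] is the vertex of the tropical line that is the limit of the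
    projections of the complex lines to the plane of the coordinates [i] and [j];
    at such a vertex the three terms of the equation have the same order. *)
Lemma line_growth (m m' s : R) : 0 < s ->
    line_limit_point (m - s) m' -> line_limit_point m (m' - s) ->
    line_limit_point (m + s) (m' + s) ->
  growth (fun t => v t 0 i / v t 0 j) (m - m') /\
  growth (fun t => plucker t / v t 0 j) m.
Proof.
move=> s0 hA hB hD.
suff main : forall e, 0 < e -> \forall t \near +oo,
    [/\ v t 0 j != 0,
        t `^ (m - m' - e) <= normc (v t 0 i / v t 0 j) <= t `^ (m - m' + e) &
        t `^ (m - e) <= normc (plucker t / v t 0 j) <= t `^ (m + e)].
  by split=> e /main; apply: filterS => t [].
move=> e0 e00.
(* With [t ^ e >= 8], the constants of [tripod_bounds] are absorbed by one power
   of [t ^ e]; the bounds have at most four such factors, and the hypothesis on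
   [S = t ^ s] has five. *)
pose e := Num.min (e0 / 4) (s / 5).
have e_gt0 : 0 < e by rewrite lt_min !divr_gt0.
have ee0 : 4 * e <= e0 by rewrite mulrC -ler_pdivlMr // ge_min lexx.
have es : 5 * e <= s by rewrite mulrC -ler_pdivlMr // ge_min lexx orbT.
near=> t.
have t1 : 1 < t by near: t; exact: nbhs_pinfty_gt.
have t0 : 0 < t by exact: lt_trans t1.
have E8 : 8 <= t `^ e by near: t; exact: powR_near_ge.
have zA : exists z, [/\ torus z, exists s, z = p t + s *: v t,
   `|m - s - Log t z 0 i| < e & `|m' - Log t z 0 j| < e] by near: t; exact: hA.
have zB : exists z, [/\ torus z, exists s, z = p t + s *: v t,
   `|m - Log t z 0 i| < e & `|m' - s - Log t z 0 j| < e] by near: t; exact: hB.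
have zD : exists z, [/\ torus z, exists s, z = p t + s *: v t,
   `|m + s - Log t z 0 i| < e & `|m' + s - Log t z 0 j| < e] by near: t; exact: hD.
have [A1 A2 A3] := trinomial_bounds t1 zA.
have [B1 B2 B3] := trinomial_bounds t1 zB.
have [D1 D2 D3] := trinomial_bounds t1 zD.
set E := t `^ e in E8; set S := t `^ s.
have E0 : 0 < E by lra.
have S0 : 0 < S by exact: powR_gt0.
have ES : 8 * E ^+ 4 <= S.
  apply: (@le_trans _ _ (E * E ^+ 4)); first by rewrite ler_wpM2r // exprn_ge0 // ltW.
  rewrite -exprS /E -powR_mulrn ?powR_ge0 // -powRrM; apply: ler_powR; first exact: ltW.
  by rewrite mulrC.
pose X := normc (v t 0 j) * t `^ m; pose Y := normc (v t 0 i) * t `^ m'.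
pose K := normc (plucker t).
have X0 : 0 <= X by rewrite mulr_ge0 ?normc_ge0 ?powR_ge0.
have Y0 : 0 <= Y by rewrite mulr_ge0 ?normc_ge0 ?powR_ge0.
have K0 : 0 <= K by exact: normc_ge0.
have powD c : t `^ (c + e) = t `^ c * E by rewrite powR_add.
have powB c : t `^ (c - e) = t `^ c / E by rewrite powR_add // powRN.
have powDS c : t `^ (c + s) = t `^ c * S by rewrite powR_add.
have powBS c : t `^ (c - s) = t `^ c / S by rewrite powR_add // powRN.
rewrite !(powD, powB, powDS, powBS) -/K in A1 A2 A3 B1 B2 B3 D1 D2 D3.
have vj0 := normc_ge0 (v t 0 j); have vi0 := normc_ge0 (v t 0 i).
have [|||||||XY YX KX XK] := @tripod_bounds X Y K E S X0 Y0 K0 _ ES; rewrite ?/X ?/Y.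
- lra.
- by move: D2; rewrite !mulrA.
- by move: D3; rewrite !mulrA.
- by move: B2; rewrite !mulrA [_ / S * E]mulrAC.
- by move: B1; rewrite !mulrA [_ / S * E]mulrAC.
- by move: A3; rewrite !mulrA [_ / S * E]mulrAC.
- by move: A1; rewrite !mulrA [_ / S * E]mulrAC.
have tm0 : 0 < t `^ m by exact: powR_gt0.
have tm'0 : 0 < t `^ m' by exact: powR_gt0.
have vj : v t 0 j != 0.
  apply/eqP => vj.
  have XX : X = 0 by rewrite /X vj ComplexField.Normc.normc0 mul0r.
  have YY : Y = 0 by apply: le_anti; rewrite Y0 andbT (le_trans YX) // XX mulr0.
  have vi : v t 0 i = 0.
    apply/eqP; rewrite -[_ == _]negbK -normc_gt0 -leNgt.
    by rewrite -(pmulr_lle0 _ tm'0) -/Y YY.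
  have [z [_ [r zE] zb _]] := zA; have [z' [_ [r' z'E] z'b _]] := zB.
  have zz' : Log t z 0 i = Log t z' 0 i by rewrite !mxE zE z'E !mxE vi !mulr0.
  move: zb z'b; rewrite zz' !ltr_norml => /andP[zb _] /andP[_ zb'].
  lra.
have X1 : 0 < X by rewrite mulr_gt0 // normc_gt0.
pose Q := t `^ e0.
have Q0 : 0 < Q by exact: powR_gt0.
have EQ : E ^+ 4 <= Q.
  rewrite /E -powR_mulrn ?powR_ge0 // -powRrM; apply: ler_powR; first exact: ltW.
  by rewrite mulrC.
have E2 : 8 * E ^+ 2 <= Q.
  apply: le_trans EQ; rewrite [leRHS](exprD _ 2 2) ler_pM2r ?exprn_gt0 // expr2.
  by apply: (@le_trans _ _ (8 * 1)); [rewrite mulr1|apply: ler_pM => //; lra].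
have E3 : 8 * E ^+ 3 <= Q by apply: le_trans EQ; rewrite [leRHS]exprS ler_pM2r ?exprn_gt0.
have E1 : 8 * E <= Q.
  by apply: le_trans E2; rewrite ler_pM2l // expr2 ler_peMr ?ltW //; lra.
have ratio c r : 0 < r -> X <= Q * r -> r <= Q * X ->
    t `^ (c - e0) <= r / X * t `^ c <= t `^ (c + e0).
  move=> r0 Xr rX; rewrite !(powR_add c) // ![t `^ c * _]mulrC !ler_pM2r ?powR_gt0 //.
  rewrite powRN -/Q ler_pdivlMr // ler_pdivrMl // Xr /=.
  by rewrite ler_pdivrMr.
have weaken c u w : 0 <= u -> 0 <= w -> 8 * c <= Q -> w <= 8 * c * u -> w <= Q * u.
  by move=> u0 w0 cQ wu; apply: le_trans wu _; rewrite ler_wpM2r.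
have Ypos : 0 < Y.
  rewrite lt_def Y0 andbT; apply/eqP => YY.
  by move: XY; rewrite YY mulr0 leNgt X1.
have Kpos : 0 < K.
  rewrite lt_def K0 andbT; apply/eqP => KK.
  by move: XK; rewrite KK mulr0 leNgt X1.
split=> //; rewrite ComplexField.Normc.normcM ComplexField.Normc.normcV.
  have -> : normc (v t 0 i) / normc (v t 0 j) = Y / X * t `^ (m - m').
    by rewrite /X /Y powR_add // powRN; field; rewrite !gt_eqF // normc_gt0.
  apply: ratio => //; apply: (weaken (E ^+ 2)) => //.
    by apply: le_trans XY _; rewrite ler_wpM2r // ler_wpM2r ?exprn_ge0 ?(ltW E0) ?ler_nat.
  by apply: le_trans YX _; rewrite ler_wpM2r // ler_wpM2r ?exprn_ge0 ?(ltW E0) ?ler_nat.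
have -> : normc (plucker t) / normc (v t 0 j) = K / X * t `^ m.
  by rewrite /X /K; field; rewrite !gt_eqF // normc_gt0.
apply: ratio => //.
  apply: (weaken E) => //.
  by apply: le_trans XK _; rewrite ler_wpM2r // ler_wpM2r ?(ltW E0) ?ler_nat.
apply: (weaken (E ^+ 3)) => //.
by apply: le_trans KX _; rewrite ler_wpM2r // ler_wpM2r ?exprn_ge0 ?(ltW E0) ?ler_nat.
Unshelve. all: by end_near.
Qed.

End LineCoefficients.

(** * Vertices of tropical lines *)

Section TropicalLineVertices.
Context {R : realType}.
Implicit Types (L : set 'rV[R]_3) (y : 'rV[R]_3) (F : set R).

Definition dir (c : 'I_4) : 'rV[R]_3 := map_mx intr (line_dir c).

Lemma coordD (x y : 'rV[R]_3) e : (x + y) 0 e = x 0 e + y 0 e.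
Proof. by rewrite mxE. Qed.

Lemma coordDZ (x y : 'rV[R]_3) (l : R) e : (x + l *: y) 0 e = x 0 e + l * y 0 e.
Proof. by rewrite !mxE. Qed.

Lemma dir0E e : dir ord0 0 e = 1.
Proof. by rewrite /dir /line_dir unlift_none !mxE. Qed.

Lemma dir_liftE (k e : 'I_3) : dir (lift ord0 k) 0 e = - (e == k)%:R.
Proof. by rewrite /dir /line_dir liftK !mxE eqxx /= rmorphN rmorph_nat. Qed.

(** After projection along the coordinate [k], the point [y] is the vertex of the
    plane tropical line that is the image of [L]; its three ends contain the
    images of points of [L] at the distance [l] from the vertex. *)
Definition projected_vertex L (k : 'I_3) y (l : R) : Prop :=
  0 < l /\ forall c, c != lift ord0 k ->
    exists2 x, L x & forall e, e != k -> x 0 e = y 0 e + l * dir c 0 e.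

Lemma sum_dir : \sum_c dir c = 0.
Proof.
rewrite big_ord_recl; apply/rowP => e; rewrite [LHS]mxE summxE dir0E [RHS]mxE.
rewrite (bigD1 e) //= dir_liftE eqxx big1 ?addr0 ?subrr // => k ke.
by rewrite dir_liftE eq_sym (negPf ke) oppr0.
Qed.

Definition two_vertex_line (p q : 'rV[R]_3) (s : {perm 'I_4}) : set 'rV[R]_3 :=
  ray p (line_dir (s (inord 0))) `|` ray p (line_dir (s (inord 1))) `|`
  segment p q `|`
  ray q (line_dir (s (inord 2))) `|` ray q (line_dir (s (inord 3))).

Definition one_vertex_line (p : 'rV[R]_3) : set 'rV[R]_3 :=
  \bigcup_(c in [set: 'I_4]) ray p (line_dir c).

Lemma perm_cover (s : {perm 'I_4}) c :
  [|| c == s (inord 0), c == s (inord 1), c == s (inord 2) | c == s (inord 3)].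
Proof.
rewrite -[c](permKV s) !(inj_eq perm_inj).
by case: (s^-1 c)%g => -[|[|[|[|//]]]] ?; rewrite -!val_eqE /= !inordK.
Qed.

Lemma perm_sum_dir (s : {perm 'I_4}) :
  dir (s (inord 0)) + dir (s (inord 1)) + dir (s (inord 2)) + dir (s (inord 3)) = 0.
Proof.
rewrite -sum_dir (reindex_inj (@perm_inj _ s)) /= 4!big_ord_recl big_ord0 addr0 !addrA.
do 3?[congr (_ + _)]; congr (dir (s _)); apply/val_inj; by rewrite /= inordK.
Qed.

(** This is for one half of a two-vertex line, seen from the vertex [y]; the other
    vertex is [x], from which the rays [c] and [c'] leave. The projection contracts
    one of these rays and aligns the bounded edge with the other one. *)
Lemma projected_vertex_half L k y x l (c c' : 'I_4) : 0 < l -> L x ->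
    x = y + l *: (dir c + dir c') -> c = lift ord0 k \/ c' = lift ord0 k ->
    (forall b, b != c -> b != c' -> L (y + l *: dir b)) ->
  projected_vertex L k y l.
Proof.
move=> l0 Lx xE ck Lb; split=> // b bk.
have [bc|bc] := eqVneq b c.
  case: ck => [ck|c'k]; first by rewrite bc ck eqxx in bk.
  exists x => // e ek; rewrite xE coordDZ coordD bc c'k dir_liftE (negPf ek).
  by rewrite oppr0 addr0.
have [bc'|bc'] := eqVneq b c'.
  case: ck => [ck|c'k]; last by rewrite bc' c'k eqxx in bk.
  exists x => // e ek; rewrite xE coordDZ coordD bc' ck dir_liftE (negPf ek).
  by rewrite oppr0 add0r.
by exists (y + l *: dir b); [exact: Lb|move=> e _; rewrite coordDZ].
Qed.

Lemma two_vertex_projected (p q : 'rV[R]_3) (s : {perm 'I_4}) (l : R) (k : 'I_3) :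
    0 < l -> q = p + l *: (dir (s (inord 2)) + dir (s (inord 3))) ->
  let L := two_vertex_line p q s in
  (lift ord0 k = s (inord 0) \/ lift ord0 k = s (inord 1) -> projected_vertex L k q l) /\
  (lift ord0 k = s (inord 2) \/ lift ord0 k = s (inord 3) -> projected_vertex L k p l).
Proof.
move=> l0 qE L.
have pE : p = q + l *: (dir (s (inord 0)) + dir (s (inord 1))).
  rewrite qE -addrA -scalerDr [X in _ *: X]addrC [X in _ *: X]addrA perm_sum_dir.
  by rewrite scaler0 addr0.
have Lp : L p by left; left; right; exists 0; rewrite ?lexx ?ler01 // scale0r addr0.
have Lq : L q by left; left; right; exists 1; rewrite ?lexx ?ler01 // scale1r addrC subrK.
split=> ks.
  apply: (projected_vertex_half l0 Lp pE); first by case: ks => ->; [left|right].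
  move=> b b0 b1; have := perm_cover s b; rewrite (negPf b0) (negPf b1) /=.
  by case/orP => /eqP ->; [left; right|right]; exists l; rewrite ?ltW.
apply: (projected_vertex_half l0 Lq qE); first by case: ks => ->; [left|right].
move=> b b2 b3; have := perm_cover s b; rewrite (negPf b2) (negPf b3) /= !orbF.
by case/orP => /eqP ->; left; left; left; [left|right]; exists l; rewrite ?ltW.
Qed.

Lemma one_vertex_projected (p : 'rV[R]_3) k :
  projected_vertex (one_vertex_line p) k p 1.
Proof.
split=> // c _; exists (p + 1 *: dir c); last by move=> e _; rewrite coordDZ.
by exists c => //; exists 1; rewrite ?ler01.
Qed.

Lemma affine_tropical_lineP L : affine_tropical_line L ->
  (exists p, L = one_vertex_line p) \/
  (exists (p q : 'rV[R]_3) (s : {perm 'I_4}) (l : R),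
    [/\ 0 < l, q = p + l *: (dir (s (inord 2)) + dir (s (inord 3))) &
        L = two_vertex_line p q s]).
Proof.
case=> [[p ->]|[p [q [s [v [l [vE l0 qE ->]]]]]]]; first by left; exists p.
right; exists p, q, s, l; split=> //; rewrite qE; congr (_ + _ *: _).
have := congr1 (map_mx (intr : int -> R)) vE; rewrite !map_mxD map_mx0 -!/(dir _).
move/eqP; rewrite addrC addr_eq0 => /eqP ->; apply/esym/eqP.
by rewrite -subr_eq0 opprK addrC addrA perm_sum_dir.
Qed.

Lemma projected_vertex_exists L k : affine_tropical_line L ->
  exists y l, projected_vertex L k y l.
Proof.
case/affine_tropical_lineP => [[p ->]|[p [q [s [l [l0 qE ->]]]]]].
  by exists p, 1; exact: one_vertex_projected.
have [qk pk] := two_vertex_projected k l0 qE.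
have /or4P[] := perm_cover s (lift ord0 k) => /eqP ks.
- by exists q, l; apply: qk; left.
- by exists q, l; apply: qk; right.
- by exists p, l; apply: pk; left.
- by exists p, l; apply: pk; right.
Qed.

Lemma pair_dir (c c' : 'I_4) (e : 'I_3) : c != c' ->
  (exists2 k, k != e & lift ord0 k = c \/ lift ord0 k = c') \/
  (forall k, k != e -> lift ord0 k != c /\ lift ord0 k != c') /\
  (dir c + dir c') 0 e = 0.
Proof.
move=> cc'.
have [ek|nk] := pselect (exists2 k, k != e & lift ord0 k = c \/ lift ord0 k = c').
  by left.
right.
have kcc' k : k != e -> lift ord0 k != c /\ lift ord0 k != c'.
  by move=> ke; split; apply/eqP => kc; apply: nk; exists k => //; [left|right].
split=> //.
have only b : b = c \/ b = c' -> b = ord0 \/ b = lift ord0 e.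
  case: (unliftP ord0 b) => [k ->|->] bcc'; [right|by left].
  congr lift; apply/eqP; apply: contraT => /kcc'[/eqP kc /eqP kc'].
  by case: bcc'.
move: cc'; have [->|->] := only c (or_introl erefl);
  have [->|->] := only c' (or_intror erefl); rewrite ?eqxx // => _.
  by rewrite coordD dir0E dir_liftE eqxx subrr.
by rewrite coordD dir0E dir_liftE eqxx addNr.
Qed.

(** If one of the rays at [q] is parallel to an axis [k <> e], then [p] is the
    vertex of the projection along [k]. Otherwise the directions of these rays are
    [(1, 1, 1)] and that of the axis [e]; then [p] and [q] have the same coordinate
    [e], and the rays at [p] are parallel to the other axes. *)
Lemma two_vertex_coordinates (p q : 'rV[R]_3) (s : {perm 'I_4}) (l : R) F :
    0 < l -> q = p + l *: (dir (s (inord 2)) + dir (s (inord 3))) ->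
    (forall k y l, projected_vertex (two_vertex_line p q s) k y l ->
      forall e, e != k -> F (y 0 e)) ->
  forall e, F (p 0 e) /\ F (q 0 e).
Proof.
move=> l0 qE LF e.
have pF k : k != e -> lift ord0 k = s (inord 2) \/ lift ord0 k = s (inord 3) ->
    F (p 0 e).
  move=> ke kp; apply: (LF k p l); last by rewrite eq_sym.
  by apply: (two_vertex_projected k l0 qE).2.
have qF k : k != e -> lift ord0 k = s (inord 0) \/ lift ord0 k = s (inord 1) ->
    F (q 0 e).
  move=> ke kq; apply: (LF k q l); last by rewrite eq_sym.
  by apply: (two_vertex_projected k l0 qE).1.
pose k0 := lift e ord0; have k0e : k0 != e by rewrite eq_sym neq_lift.
have s23 : s (inord 2) != s (inord 3).
  by rewrite (inj_eq perm_inj) -val_eqE /= !inordK.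
have s01 : s (inord 0) != s (inord 1).
  by rewrite (inj_eq perm_inj) -val_eqE /= !inordK.
have pE : p = q + l *: (dir (s (inord 0)) + dir (s (inord 1))).
  rewrite qE -addrA -scalerDr [X in _ *: X]addrC [X in _ *: X]addrA perm_sum_dir.
  by rewrite scaler0 addr0.
have [[k ke kp]|[np sum0]] := pair_dir e s23.
  have [[k' k'e k'q]|[nq sum0]] := pair_dir e s01.
    by split; [exact: pF kp|exact: qF k'q].
  have -> : q 0 e = p 0 e by rewrite pE coordDZ sum0 mulr0 addr0.
  by split; exact: pF kp.
have -> : p 0 e = q 0 e by rewrite qE coordDZ sum0 mulr0 addr0.
have [/negPf n2 /negPf n3] := np _ k0e.
have k0q : lift ord0 k0 = s (inord 0) \/ lift ord0 k0 = s (inord 1).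
  by have /or4P[/eqP|/eqP|/idP|/idP] := perm_cover s (lift ord0 k0);
    [left|right|rewrite n2|rewrite n3].
by split; exact: qF k0q.
Qed.

Lemma finite_range_finType (I : finType) (T : Type) (f : I -> T) :
  finite_set (range f).
Proof. by apply: finite_image; exact: finite_finset. Qed.

(** A tropical line is determined by its vertices and by the distribution of the
    four rays between them. *)
Lemma finitely_many_lines F : finite_set F ->
  finite_set [set L | affine_tropical_line L /\
    forall k y l, projected_vertex L k y l -> forall e, e != k -> F (y 0 e)].
Proof.
case/finite_seqP => r FE.
pose pt (g : {ffun 'I_3 -> 'I_(size r)}) : 'rV[R]_3 := \row_e nth 0 r (g e).
have ptE (y : 'rV[R]_3) : (forall e, F (y 0 e)) -> exists g, y = pt g.
  move=> yF; have /choice[g yE] e : exists j : 'I_(size r), y 0 e = nth 0 r j.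
    have := yF e; rewrite FE /= -index_mem => er.
    by exists (Ordinal er); rewrite nth_index // -index_mem.
  by exists [ffun e => g e]; apply/rowP => e; rewrite mxE ffunE.
pose line (x : {ffun 'I_3 -> 'I_(size r)} +
    {ffun 'I_3 -> 'I_(size r)} * {ffun 'I_3 -> 'I_(size r)} * {perm 'I_4}) :=
  match x with
  | inl g => one_vertex_line (pt g)
  | inr (g, h, s) => two_vertex_line (pt g) (pt h) s
  end.
apply: sub_finite_set (finite_range_finType line) => L [Lline LF].
case/affine_tropical_lineP: Lline LF => [[p ->]|[p [q [s [l [l0 qE ->]]]]]] LF.
  have [|g ->] := ptE p; last by exists (inl g).
  move=> e; apply: (LF (lift e ord0) p 1 (one_vertex_projected _ _)).
  exact: neq_lift.
have pq := two_vertex_coordinates l0 qE LF.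
have [|g ->] := ptE p; first by move=> e; have [] := pq e.
have [|h ->] := ptE q; first by move=> e; have [] := pq e.
by exists (inr (g, h, s)).
Qed.

End TropicalLineVertices.

(** * Surfaces that contain a line *)

Section PolyCoefficients.
Context {C : fieldType} {I : finType}.
Implicit Types (g h : (I -> C) -> {poly C}).

Definition poly_coef_fun g : Prop := forall r, poly_fun (fun x => (g x)`_r).

Lemma poly_coef_funM g h : poly_coef_fun g -> poly_coef_fun h ->
  poly_coef_fun (fun x => g x * h x).
Proof.
move=> gp hp r; apply: eq_poly_fun (fun x => esym (coefM (g x) (h x) r)) _.
by apply: poly_fun_sum => j; exact: poly_funM.
Qed.

Lemma poly_coef_fun_cst (q : {poly C}) : poly_coef_fun (fun=> q).
Proof. by move=> r; exact: poly_fun_cst. Qed.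

Lemma poly_coef_funX g n : poly_coef_fun g -> poly_coef_fun (fun x => g x ^+ n).
Proof.
move=> gp; elim: n => [|n IHn]; first exact: poly_coef_fun_cst.
by move=> r; under eq_fun do rewrite exprS; exact: poly_coef_funM.
Qed.

Lemma poly_coef_fun_linear i j : poly_coef_fun (fun x => x i *: 'X + (x j)%:P).
Proof.
move=> r; apply: (eq_poly_fun (f := fun x => x i * ('X : {poly C})`_r + x j * (r == 0)%:R)).
  by move=> x; rewrite !coefE; case: r => [|r]; rewrite ?mulr1 ?mulr0.
apply: poly_funD; apply: poly_funM; try exact: poly_fun_var; exact: poly_fun_cst.
Qed.

End PolyCoefficients.

Section LineInSurface.
Context {R : realType} {d : nat}.
Local Notation C := R[i].
Local Notation coord := Defs.coord.
Implicit Types (i : lattice_pt d).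

Definition axis0 : 'I_3 := inord 0.
Definition axis1 : 'I_3 := inord 1.
Definition axis2 : 'I_3 := inord 2.

Lemma ord3P (j : 'I_3) : [\/ j = axis0, j = axis1 | j = axis2].
Proof.
by case: j => -[|[|[|//]]] jP; [apply: Or31|apply: Or32|apply: Or33];
  apply/val_inj; rewrite /= inordK.
Qed.

Definition on_axis i : bool := (coord i axis1 == 0) && (coord i axis2 == 0).

(** The coefficients of the monomials off the first axis and the four
    coefficients of the equations [z1 = al z0 + be, z2 = ga z0 + de] of the line. *)
Definition line_param : finType := ({i : lattice_pt d | ~~ on_axis i} + 'I_4)%type.

Definition axis_exponents (n : 'I_d.+1) : {ffun 'I_3 -> 'I_d.+1} :=
  [ffun j => if j == axis0 then n else ord0].

Lemma axis_exponents_le n : (\sum_j axis_exponents n j <= d)%N.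
Proof.
rewrite (bigD1 axis0) //= ffunE eqxx big1 ?addn0 ?leq_ord // => j /negPf j0.
by rewrite ffunE j0.
Qed.

Definition axis_pt n : lattice_pt d :=
  exist (fun i : {ffun 'I_3 -> 'I_d.+1} => (\sum_j i j <= d)%N) _ (axis_exponents_le n).

(** The four coefficients of the line replace the [d + 1] coefficients on the
    axis. *)
Lemma card_line_param : (#|line_param| + d <= #|{: lattice_pt d}| + 3)%N.
Proof.
have off_axis : #|{: {i : lattice_pt d | ~~ on_axis i}}| = #|[predC on_axis]|.
  by rewrite card_sig; apply: eq_card.
have total := cardC on_axis.
have arith (m n k : nat) : (m + n = k -> d.+1 <= m -> n + 4 + d <= k + 3)%N by lia.
suff : (d.+1 <= #|on_axis|)%N.
  by rewrite card_sum card_ord off_axis; exact: arith total.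
have inj : injective axis_pt.
  move=> m n /(congr1 (fun i => coord i axis0)); rewrite /coord /= !ffunE eqxx.
  exact: val_inj.
rewrite -[d.+1]card_ord -(card_imset _ inj).
apply: subset_leq_card; apply/fintype.subsetP => _ /imsetP[n _ ->].
by rewrite -topredE /= /on_axis /coord /= !ffunE -!val_eqE /= !inordK.
Qed.

Definition line_poly (x : line_param -> C) i : {poly C} :=
  'X ^+ coord i axis0 * (x (inr (inord 0)) *: 'X + (x (inr (inord 1)))%:P) ^+ coord i axis1
  * (x (inr (inord 2)) *: 'X + (x (inr (inord 3)))%:P) ^+ coord i axis2.

(** On the line, the monomials on the first axis are the powers of [z0]; their
    coefficients are determined by the other ones as the restriction of the
    polynomial to the line vanishes. *)
Definition surface_coeff i (x : line_param -> C) : C :=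
  match insub i : option {i : lattice_pt d | ~~ on_axis i} with
  | Some i' => x (inl i')
  | None => - \sum_(i' : {i : lattice_pt d | ~~ on_axis i})
                x (inl i') * (line_poly x (val i'))`_(coord i axis0)
  end.

Lemma poly_fun_surface_coeff i : poly_fun (surface_coeff i).
Proof.
rewrite /surface_coeff; case: insub => [i'|]; first exact: poly_fun_var.
apply: poly_funN; apply: poly_fun_sum => i'; apply: poly_funM; first exact: poly_fun_var.
move: (coord i axis0); apply: poly_coef_funM; last first.
  by apply: poly_coef_funX; exact: poly_coef_fun_linear.
apply: poly_coef_funM; first exact: poly_coef_fun_cst.
by apply: poly_coef_funX; exact: poly_coef_fun_linear.
Qed.

(** These are [al], [be], [ga], [de], in this order, for the line through [p] with
    direction [v]. *)
Definition line_coeffs (p v : 'rV[C]_3) (r : 'I_4) : C :=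
  match val r with
  | 0 => v 0 axis1 / v 0 axis0
  | 1 => (v 0 axis0 * p 0 axis1 - v 0 axis1 * p 0 axis0) / v 0 axis0
  | 2 => v 0 axis2 / v 0 axis0
  | _ => (v 0 axis0 * p 0 axis2 - v 0 axis2 * p 0 axis0) / v 0 axis0
  end.

Definition surface_param (P : lattice_pt d -> C) (p v : 'rV[C]_3) (r : line_param) : C :=
  match r with inl i => P (val i) | inr r => line_coeffs p v r end.

Lemma poly_eq0_infinite (F : numFieldType) (q : {poly F}) :
  (forall x, q.[x] = 0) -> q = 0.
Proof.
move=> q0; apply/eqP; apply: contraT => qn0.
have := max_poly_roots qn0 (rs := [seq n%:R | n <- iota 0 (size q)]).
rewrite size_map size_iota ltnn => H; apply: H.
  by apply/allP => _ /mapP[n _ ->]; rewrite /root q0.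
by rewrite map_inj_uniq ?iota_uniq // => m n /eqP; rewrite eqr_nat => /eqP.
Qed.

Lemma surface_coeffE (P : lattice_pt d -> C) (p v : 'rV[C]_3) i :
    (forall j, v 0 j != 0) ->
    (forall s : C, torus (p + s *: v) ->
      \sum_i P i * \prod_j (p + s *: v) 0 j ^+ coord i j = 0) ->
  P i = surface_coeff i (surface_param P p v).
Proof.
move=> v0 line0; set x := surface_param P p v.
pose q : {poly C} := \sum_i P i *: line_poly x i.
pose l1 := x (inr (inord 0)) *: 'X + (x (inr (inord 1)))%:P : {poly C}.
pose l2 := x (inr (inord 2)) *: 'X + (x (inr (inord 3)))%:P : {poly C}.
have q0 : q = 0.
  have : q * ('X * l1 * l2) = 0.
    (* The factor [X l1 l2] takes care of the points outside of the torus. *)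
    apply: poly_eq0_infinite => z.
    pose s := (z - p 0 axis0) / v 0 axis0; pose y := p + s *: v.
    have y0 : y 0 axis0 = z by rewrite /y /s !mxE divfK // addrC subrK.
    have y1 : y 0 axis1 = l1.[z].
      rewrite /l1 /x /= /line_coeffs /= !inordK // !hornerE /y !mxE /s.
      by field.
    have y2 : y 0 axis2 = l2.[z].
      rewrite /l2 /x /= /line_coeffs /= !inordK // !hornerE /y !mxE /s.
      by field.
    have prod3 (f : 'I_3 -> C) : \prod_j f j = f axis0 * f axis1 * f axis2.
      rewrite !big_ord_recl big_ord0 mulr1 mulrA.
      by do 2?[congr (_ * _)]; congr f; apply/val_inj; rewrite /= inordK.
    have [yT|nyT] := pselect (torus y).
      rewrite hornerM; apply/eqP; rewrite mulf_eq0; apply/orP; left; apply/eqP.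
      rewrite -(line0 s yT) horner_sum; apply: eq_bigr => k _.
      rewrite hornerZ prod3 y0 y1 y2 /line_poly -/l1 -/l2.
      by rewrite !hornerM !horner_exp hornerX.
    have [j yj] : exists j, y 0 j = 0.
      by apply: contrapT => /forallNP nj; apply: nyT => j; apply/eqP/nj.
    rewrite !hornerM hornerX.
    by have [jE|jE|jE] := ord3P j; move: yj; rewrite jE ?y0 ?y1 ?y2 => ->;
      rewrite ?(mulr0, mul0r).
  have linear_neq0 (b c : C) : b != 0 -> b *: 'X + c%:P != 0 :> {poly C}.
    apply: contraNneq => /(congr1 (fun r : {poly C} => r`_1)).
    by rewrite !coefE /= mulr1 addr0 => ->.
  have l10 : l1 != 0.
    by apply: linear_neq0; rewrite /x /= /line_coeffs /= inordK // mulf_neq0 ?invr_neq0.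
  have l20 : l2 != 0.
    by apply: linear_neq0; rewrite /x /= /line_coeffs /= inordK // mulf_neq0 ?invr_neq0.
  move=> /eqP; rewrite !mulf_eq0 polyX_eq0 (negPf l10) (negPf l20) !orbF => /eqP; exact.
rewrite /surface_coeff; case: insubP => [i' _ iE|]; first by rewrite /= iE.
rewrite negbK => iax; apply/eqP; rewrite -addr_eq0; apply/eqP.
have qn := congr1 (fun r : {poly C} => r`_(coord i axis0)) q0.
rewrite coef_sum coef0 (bigID on_axis) /= in qn; rewrite -[RHS]qn; congr (_ + _).
  rewrite (bigD1 i) //= big1 ?addr0 => [|k /andP[kax ki]].
    have /andP[/eqP c1 /eqP c2] := iax.
    by rewrite coefZ /line_poly c1 c2 !mulr1 coefXn eqxx mulr1.
  have /andP[/eqP c1 /eqP c2] := kax; have /andP[/eqP c1' /eqP c2'] := iax.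
  rewrite coefZ /line_poly c1 c2 !mulr1 coefXn; case: eqP => [c0|_]; last by rewrite mulr0.
  case/eqP: ki; apply/val_inj/ffunP => j; apply/val_inj.
  suff : coord k j = coord i j by [].
  by have [->|->|->] := ord3P j; rewrite ?c0 ?c1 ?c1' ?c2 ?c2'.
rewrite [RHS](reindex_omap (val : {i | ~~ on_axis i} -> _) insub) /=; last first.
  by move=> k kax; rewrite insubT.
apply: eq_big => [k|k _]; first by rewrite valK eqxx andbT (valP k).
by rewrite coefZ.
Qed.

End LineInSurface.
Arguments line_param : clear implicits.

(** * Orders of growth of an approximating family *)

Section Approximation.
Context {R : realType} {d : nat}.
Local Notation C := R[i].
Implicit Types (a : lattice_pt d -> R) (L : set 'rV[R]_3).

(** The quantities whose orders of growth determine a tropical line that is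
    approximated: the coefficients [al, be, ga, de] of the equations
    [z1 = al z0 + be, z2 = ga z0 + de] and the minor [al de - be ga], together
    with [1], so that each coordinate is a difference of two orders. *)
Definition line_quantity (r : option (option 'I_4)) (x : line_param d -> C) : C :=
  match r with
  | Some (Some r) => x (inr r)
  | Some None => x (inr (inord 0)) * x (inr (inord 3)) -
                 x (inr (inord 1)) * x (inr (inord 2))
  | None => 1
  end.

Lemma poly_fun_line_quantity r : poly_fun (line_quantity r).
Proof.
case: r => [[r|]|] /=; [exact: poly_fun_var| |exact: poly_fun_cst].
apply: poly_funD; first by apply: poly_funM; exact: poly_fun_var.
by apply: poly_funN; apply: poly_funM; exact: poly_fun_var.
Qed.

Lemma sub_affine_part (X : set 'rV[R]_3) : X `<=` affine_part (TP3_closure X).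
Proof. by move=> x Xx; apply: subset_closure; exists x. Qed.

(** The three points of [L] over the ends of its projection are limits of points
    of the complex lines. *)
Lemma projected_growth L (p v : R -> 'rV[C]_3) (i j k : 'I_3) y l :
    (forall x e, L x -> 0 < e -> \forall t \near +oo, exists z,
      [/\ torus z, exists s, z = p t + s *: v t & `|x - Log t z| < e]) ->
    projected_vertex L k y l -> i != j -> i != k -> j != k ->
  growth (fun t => v t 0 i / v t 0 j) (y 0 i - y 0 j) /\
  growth (fun t => plucker p v i j t / v t 0 j) (y 0 i).
Proof.
move=> Lapprox [l0 Ly] ij ik jk.
have pts c b b' : c != lift ord0 k -> b = y 0 i + l * dir c 0 i ->
    b' = y 0 j + l * dir c 0 j -> line_limit_point p v i j b b'.
  move=> /Ly[x Lx xE] bE b'E e e0; apply: filterS (Lapprox x e Lx e0) => t [z [zT zL xz]].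
  exists z; split=> //.
    rewrite bE -xE // (le_lt_trans _ xz) // -[_ - _](_ : (x - Log t z) 0 i = _).
      exact: normr_coord.
    by rewrite !mxE.
  rewrite b'E -xE // (le_lt_trans _ xz) // -[_ - _](_ : (x - Log t z) 0 j = _).
    exact: normr_coord.
  by rewrite !mxE.
have lift_neq c c' : c != c' -> lift ord0 c != lift ord0 c' :> 'I_4.
  by rewrite (inj_eq lift_inj).
apply: (line_growth l0).
- apply: (pts (lift ord0 i)); first exact: lift_neq.
    by rewrite dir_liftE eqxx mulrN1.
  by rewrite dir_liftE eq_sym (negPf ij) oppr0 mulr0 addr0.
- apply: (pts (lift ord0 j)); first exact: lift_neq.
    by rewrite dir_liftE (negPf ij) oppr0 mulr0 addr0.
  by rewrite dir_liftE eqxx mulrN1.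
- by apply: (pts ord0); rewrite ?dir0E ?mulr1 // neq_lift.
Qed.

(** The coordinates of the vertex of a projection of [L] are the orders of the
    quotients of the coefficients of an equation of the complex lines. For the
    projections along the second and the third axis these are the two given
    equations; for the one along the first axis it is the equation between [z1]
    and [z2], whose coefficients are [ga / al] and the minor divided by [al]. *)
Lemma approximable_growth a L :
    primitive_triangulation (dual_subdivision a) -> affine_tropical_line L ->
    approximable d (tropical_surface a) (TP3_closure L) ->
  exists2 x : R -> line_param d -> C,
    forall i, growth (fun t => surface_coeff i (x t)) (a i) &
    forall k y l, projected_vertex L k y l -> forall e, e != k ->
      exists r r' b b', [/\ growth (fun t => line_quantity r (x t)) b,
        growth (fun t => line_quantity r' (x t)) b' & y 0 e = b - b'].
Proof.
move=> Tprim Lline [St [Lt [StLt [Slim _] [Llim _]]]].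
have /choice[P PE] (t : R) : exists P : lattice_pt d -> C, 1 < t ->
    newton_polytope P = Delta R d /\ St t = @torus R 3 `&`
      [set z | \sum_i P i * \prod_j z 0 j ^+ Defs.coord i j = 0].
  have [t1|t1] := ltP 1 t; last by exists (fun=> 0).
  by have [[P PD PE] _ _] := StLt t t1; exists P.
have /choice[pv pvE] (t : R) : exists pv : 'rV[C]_3 * 'rV[C]_3, 1 < t ->
    Lt t = @torus R 3 `&` [set z | exists s : C, z = pv.1 + s *: pv.2].
  have [t1|t1] := ltP 1 t; last by exists (0, 0).
  by have [_ [p [v [_ LE]]] _] := StLt t t1; exists (p, v).
pose p t := (pv t).1; pose v t := (pv t).2.
have P_neq0 t : 1 < t -> exists i, P t i != 0.
  by move=> t1; have [PD _] := PE t t1; exact: newton_polytope_neq0.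
have P_approx x e : affine_tropical_surface a x -> 0 < e ->
    \forall t \near +oo, exists z, [/\ torus z,
      \sum_i P t i * \prod_j z 0 j ^+ Defs.coord i j = 0 & `|x - Log t z| < e].
  move=> ax e0; near=> t.
  have t1 : 1 < t by near: t; exact: nbhs_pinfty_gt.
  have [_ [z zS <-] xz] : exists2 y, (Log t @` St t) y & `|x - y| < e.
    by near: t; apply: hausdorff_limit_near Slim _ e0; exact: sub_affine_part.
  by move: zS; rewrite (PE t t1).2 => -[zT z0]; exists z.
have L_approx x e : L x -> 0 < e -> \forall t \near +oo, exists z,
    [/\ torus z, exists s, z = p t + s *: v t & `|x - Log t z| < e].
  move=> Lx e0; near=> t.
  have t1 : 1 < t by near: t; exact: nbhs_pinfty_gt.
  have [_ [z zL <-] xz] : exists2 y, (Log t @` Lt t) y & `|x - y| < e.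
    by near: t; apply: hausdorff_limit_near Llim _ e0; exact: sub_affine_part.
  by move: zL; rewrite (pvE t t1) => -[zT z0]; exists z.
have Lgrowth i j k y l := @projected_growth L p v i j k y l L_approx.
pose P' t i := P t i / ((max_coeff a P t)%:C)%C.
pose x t := surface_param (P' t) (p t) (v t).
have neq10 : axis1 != axis0 by rewrite -val_eqE /= !inordK.
have neq20 : axis2 != axis0 by rewrite -val_eqE /= !inordK.
have neq21 : axis2 != axis1 by rewrite -val_eqE /= !inordK.
have neq01 : axis0 != axis1 by rewrite eq_sym.
have neq02 : axis0 != axis2 by rewrite eq_sym.
have neq12 : axis1 != axis2 by rewrite eq_sym.
have [y2 [l2 y2L]] := projected_vertex_exists axis2 Lline.
have [y1 [l1 y1L]] := projected_vertex_exists axis1 Lline.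
have [al al_growth] : exists al, growth (fun t => v t 0 axis1 / v t 0 axis0) al.
  have [H _] := Lgrowth axis1 axis0 axis2 _ _ y2L neq10 neq12 neq02.
  by exists (y2 0 axis1 - y2 0 axis0).
have [ga ga_growth] : exists ga, growth (fun t => v t 0 axis2 / v t 0 axis0) ga.
  have [H _] := Lgrowth axis2 axis0 axis1 _ _ y1L neq20 neq21 neq01.
  by exists (y1 0 axis2 - y1 0 axis0).
have v_neq0 : \forall t \near +oo, forall j, v t 0 j != 0.
  apply: filterS2 (growth_neq0 al_growth) (growth_neq0 ga_growth) => t.
  rewrite !mulf_eq0 !invr_eq0 !negb_or => /andP[v1 v0] /andP[v2 _] j.
  by have [->|->|->] := ord3P j.
exists x.
  move=> i; apply: eq_growth (coeff_growth P_neq0 P_approx Tprim i).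
  near=> t; have t1 : 1 < t by near: t; exact: nbhs_pinfty_gt.
  apply: surface_coeffE => [|s sT]; first by near: t.
  have : Lt t (p t + s *: v t) by rewrite (pvE t t1); split=> //; exists s.
  have [_ _ /[apply]] := StLt t t1; rewrite (PE t t1).2 => -[_ z0].
  under eq_bigr do rewrite /P' mulrAC; rewrite -mulr_suml.
  by rewrite [X in X * _]z0 mul0r.
have alE t : x t (inr (inord 0)) = v t 0 axis1 / v t 0 axis0.
  by rewrite /x /= /line_coeffs /= inordK.
have beE t : x t (inr (inord 1)) = plucker p v axis1 axis0 t / v t 0 axis0.
  by rewrite /x /= /line_coeffs /= inordK.
have gaE t : x t (inr (inord 2)) = v t 0 axis2 / v t 0 axis0.
  by rewrite /x /= /line_coeffs /= inordK.
have deE t : x t (inr (inord 3)) = plucker p v axis2 axis0 t / v t 0 axis0.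
  by rewrite /x /= /line_coeffs /= inordK.
have q0 : growth (fun t => line_quantity None (x t)) 0 by exact: growth_cst (oner_neq0 _).
have quantity r f b : (forall t, f t = x t (inr (inord r))) -> growth f b ->
    growth (fun t => line_quantity (Some (Some (inord r))) (x t)) b.
  by move=> fE; apply: eq_growth; near=> t; rewrite fE.
have minorE t : line_quantity (Some None) (x t) =
    (v t 0 axis1 * p t 0 axis2 - v t 0 axis2 * p t 0 axis1) / v t 0 axis0.
  rewrite /line_quantity alE beE gaE deE /plucker.
  have [->|v00] := eqVneq (v t 0 axis0) 0; first by rewrite invr0 !mulr0 subrr.
  by field.
have minor_growth b : growth (fun t => plucker p v axis2 axis1 t / v t 0 axis1) b ->
    growth (fun t => line_quantity (Some None) (x t)) (b + al).
  move=> bg; apply: eq_growth (growthM bg al_growth).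
  near=> t; rewrite minorE /plucker.
  have vt : forall j, v t 0 j != 0 by near: t.
  by field; rewrite !vt.
have ga_growth' b : growth (fun t => v t 0 axis2 / v t 0 axis1) b ->
    growth (fun t => line_quantity (Some (Some (inord 2))) (x t)) (b + al).
  move=> bg; apply: eq_growth (growthM bg al_growth).
  near=> t; rewrite /line_quantity gaE.
  have vt : forall j, v t 0 j != 0 by near: t.
  by field; rewrite !vt.
move=> k y l yL e ek.
have [kE|kE|kE] := ord3P k; rewrite kE in yL ek; have [eE|eE|eE] := ord3P e;
  rewrite eE ?eqxx // in ek *.
- have [vg pg] := Lgrowth axis2 axis1 axis0 _ _ yL neq21 neq20 neq10.
  exists (Some None), (Some (Some (inord 2))), (y 0 axis2 + al), (y 0 axis2 - y 0 axis1 + al).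
  by split; [exact: minor_growth|exact: ga_growth'|ring].
- have [vg pg] := Lgrowth axis2 axis1 axis0 _ _ yL neq21 neq20 neq10.
  exists (Some None), (Some (Some (inord 0))), (y 0 axis2 + al), al.
  split; [exact: minor_growth|exact: quantity al_growth|by rewrite addrK].
- have [vg pg] := Lgrowth axis2 axis0 axis1 _ _ yL neq20 neq21 neq01.
  exists (Some (Some (inord 3))), (Some (Some (inord 2))), (y 0 axis2), (y 0 axis2 - y 0 axis0).
  split; [exact: quantity pg|exact: quantity vg|by rewrite opprB addrC subrK].
- have [vg pg] := Lgrowth axis2 axis0 axis1 _ _ yL neq20 neq21 neq01.
  exists (Some (Some (inord 3))), None, (y 0 axis2), 0.
  by split; [exact: quantity pg|exact: q0|rewrite subr0].
- have [vg pg] := Lgrowth axis1 axis0 axis2 _ _ yL neq10 neq12 neq02.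
  exists (Some (Some (inord 1))), (Some (Some (inord 0))), (y 0 axis1), (y 0 axis1 - y 0 axis0).
  split; [exact: quantity pg|exact: quantity vg|by rewrite opprB addrC subrK].
- have [vg pg] := Lgrowth axis1 axis0 axis2 _ _ yL neq10 neq12 neq02.
  exists (Some (Some (inord 1))), None, (y 0 axis1), 0.
  by split; [exact: quantity pg|exact: q0|rewrite subr0].
Unshelve. all: by end_near.
Qed.

Lemma generic_coeffs_leq D D' a : (D <= D')%N -> generic_coeffs D' a -> generic_coeffs D a.
Proof.
move=> DD' ainj u u' uu'.
pose widen (w : {ffun lattice_pt d -> 'I_D}) := [ffun i => widen_ord DD' (w i)].
have widenE w : \sum_i (widen w i)%:R * a i = \sum_i (w i)%:R * a i :> R.
  by apply: eq_bigr => i _; rewrite ffunE.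
have /ffunP widen_uu' : widen u = widen u' by apply: ainj; rewrite !widenE.
apply/ffunP => i; apply/val_inj.
by have := congr1 val (widen_uu' i); rewrite !ffunE.
Qed.

(** When there are fewer parameters than coefficients, these satisfy an algebraic
    relation, and the orders of growth of the coefficients a linear one. *)
Lemma no_growth : (#|line_param d| < #|{: lattice_pt d}|)%N ->
  exists D, forall a, generic_coeffs D a -> forall x : R -> line_param d -> C,
    ~ forall i, growth (fun t => surface_coeff i (x t)) (a i).
Proof.
move=> card_lt.
have [D [c [c0 rel]]] := algebraically_dependent (C := R[i]) card_lt poly_fun_surface_coeff.
exists D => a ainj x growth_a.
have [|m [m' [mm' /ainj mE]]] := tropical_relation c0 growth_a.
  by near=> t; exact: rel.
by rewrite mE eqxx in mm'.
Unshelve. all: by end_near.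
Qed.

(** When there are as many parameters as coefficients, a further polynomial [q] in
    the parameters is related to the coefficients. As the orders of growth of these
    are in general position, [q] occurs with different exponents in two monomials
    of maximal order, which determines its order of growth. *)
Lemma finite_growth (q : (line_param d -> C) -> C) : poly_fun q ->
    (#|line_param d| <= #|{: lattice_pt d}|)%N ->
  exists D, forall a, generic_coeffs D a -> exists2 F, finite_set F &
    forall (x : R -> line_param d -> C) b,
      (forall i, growth (fun t => surface_coeff i (x t)) (a i)) ->
      growth (fun t => q (x t)) b -> F b.
Proof.
move=> qp card_le.
pose F (j : 'I_1 + lattice_pt d) := match j with inl _ => q | inr i => surface_coeff i end.
have card_lt : (#|line_param d| < #|{: 'I_1 + lattice_pt d}|)%N.
  by rewrite [X in (_ < X)%N]card_sum card_ord add1n ltnS.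
have Fp j : poly_fun (F j) by case: j => [_|i] //; exact: poly_fun_surface_coeff.
have [D [c [c0 rel]]] := algebraically_dependent card_lt Fp.
exists D => a ainj.
pose M : finType := {ffun 'I_1 + lattice_pt d -> 'I_D}.
pose w (m : M) : R := \sum_i (m (inr i))%:R * a i.
pose order (mm : M * M) :=
  (w mm.2 - w mm.1) / ((mm.1 (inl ord0))%:R - (mm.2 (inl ord0))%:R).
exists (range order); first exact: finite_range_finType.
move=> x b growth_a growth_q.
pose bb (j : 'I_1 + lattice_pt d) := match j with inl _ => b | inr i => a i end.
have growth_F j : growth (fun t => F j (x t)) (bb j) by case: j.
have [|m [m' [mm' mE]]] := tropical_relation c0 growth_F.
  by near=> t; exact: rel.
rewrite !big_sumType !big_ord1 /= -/(w m) -/(w m') in mE.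
have [m0|m0] := eqVneq ((m (inl ord0))%:R : R) (m' (inl ord0))%:R.
  have /ainj/ffunP mr : \sum_i ([ffun i => m (inr i)] i)%:R * a i =
      \sum_i ([ffun i => m' (inr i)] i)%:R * a i :> R.
    move: mE; rewrite m0 => /addrI; rewrite /w => wE.
    under eq_bigr do rewrite ffunE; rewrite wE.
    by apply: eq_bigr => i _; rewrite ffunE.
  case/eqP: mm'; apply/ffunP => -[j|i]; last by have := mr i; rewrite !ffunE.
  by apply/val_inj/eqP; rewrite ord1 -(eqr_nat R) m0.
exists (m, m') => //; apply: (canLR (mulfK _)); first by rewrite subr_eq0.
by rewrite mulrBr ![b * _]mulrC; move: mE; lra.
Unshelve. all: by end_near.
Qed.

End Approximation.

(** * Approximable lines in generic surfaces *)

Lemma approximable_cubic (R : realType) : exists D, forall a : lattice_pt 3 -> R,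
    primitive_triangulation (dual_subdivision a) -> generic_coeffs D a ->
  finite_set [set L | [/\ tropical_line L, L `<=` tropical_surface a
                        & approximable 3 (tropical_surface a) L]].
Proof.
have card_le : (#|line_param 3| <= #|{: lattice_pt 3}|)%N.
  by have := card_line_param (d := 3); rewrite leq_add2r.
have /choice[D DP] r := finite_growth (poly_fun_line_quantity (R := R) r) card_le.
exists (\max_r D r) => a Tprim agen.
have /choice[F FP] r : exists F, finite_set F /\
    forall (x : R -> line_param 3 -> R[i]) b,
      (forall i, growth (fun t => surface_coeff i (x t)) (a i)) ->
      growth (fun t => line_quantity r (x t)) b -> F b.
  by have [F] := DP r a (generic_coeffs_leq (leq_bigmax r) agen); exists F.
pose G := \bigcup_(r in setT) \bigcup_(r' in setT) [set b - b' | b in F r & b' in F r'].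
have Gfin : finite_set G.
  apply: bigcup_finite => // r _; apply: bigcup_finite => // r' _.
  by apply: finite_image2; [exact: (FP r).1|exact: (FP r').1].
apply: sub_finite_set (finite_image TP3_closure (finitely_many_lines Gfin)) => L.
case=> -[L0 L0line ->] _ L0approx; exists L0 => //; split=> // k y l yL e ek.
have [x x_coeff /(_ k y l yL e ek)[r [r' [b [b' [rb r'b' ->]]]]]] :=
  approximable_growth Tprim L0line L0approx.
exists r => //; exists r' => //.
by exists b; [exact: (FP r).2 rb|exists b' => //; exact: (FP r').2 r'b'].
Qed.

Lemma not_approximable (R : realType) (d : nat) : (4 <= d)%N ->
  exists D, forall a : lattice_pt d -> R,
    primitive_triangulation (dual_subdivision a) -> generic_coeffs D a ->
  ~ exists L, [/\ tropical_line L, L `<=` tropical_surface a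
                & approximable d (tropical_surface a) L].
Proof.
move=> d4.
have card_lt : (#|line_param d| < #|{: lattice_pt d}|)%N.
  by have := card_line_param (d := d); lia.
have [D DP] := no_growth (R := R) card_lt; exists D => a Tprim agen.
case=> _ [[L0 L0line ->] _ L0approx].
have [x x_coeff _] := approximable_growth Tprim L0line L0approx.
exact: DP agen x x_coeff.
Qed.

Theorem theorem1p8 (R : realType) (d : nat) (T : {set {set lattice_pt d}}) :
  @regular_primitive_triangulation R d T ->
  generically T (fun a : lattice_pt d -> R =>
    let S := tropical_surface a in
    (d = 3%N ->
       finite_set [set L | [/\ tropical_line L, L `<=` S & approximable d S L]]) /\
    ((4 <= d)%N ->
       ~ exists L, [/\ tropical_line L, L `<=` S & approximable d S L])).
Proof.
move=> Treg; have [_ Tprim] := Treg.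
have [D3 D3P] : exists D, d = 3%N -> forall a : lattice_pt d -> R,
    primitive_triangulation (dual_subdivision a) -> generic_coeffs D a ->
    finite_set [set L | [/\ tropical_line L, L `<=` tropical_surface a
                          & approximable d (tropical_surface a) L]].
  have [d3|d3] := eqVneq d 3%N; last by exists 0%N => /eqP; rewrite (negPf d3).
  have [D DP] := approximable_cubic R; exists D => _.
  by move: (d) d3 => _ ->.
have [D4 D4P] : exists D, (4 <= d)%N -> forall a : lattice_pt d -> R,
    primitive_triangulation (dual_subdivision a) -> generic_coeffs D a ->
    ~ exists L, [/\ tropical_line L, L `<=` tropical_surface a
                  & approximable d (tropical_surface a) L].
  have [d4|_] := leqP 4 d; last by exists 0%N.
  by have [D DP] := not_approximable R d4; exists D.
apply: (generically_generic_coeffs (D := maxn D3 D4) Treg) => a aT agen.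
rewrite -aT in Tprim; split=> [d3|d4].
  exact: D3P d3 a Tprim (generic_coeffs_leq (leq_maxl _ _) agen).
exact: D4P d4 a Tprim (generic_coeffs_leq (leq_maxr _ _) agen).
Qed.
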